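(* We have the following results: (1) The quantum group $G\subset S_N^+$ associated to a complex Hadamard matrix $H\in M_N(\mathbb C)$ is doubly transitive precisely when the profile graph of $H$ is connected. (2) The quantum groups $G\subset S_{N^2}^+$ associated to the standard Weyl matrices, coming from $\mathbb Z_N\times\mathbb Z_N$ with Fourier cocycle, are doubly transitive.
   Context: A magic unitary is a square matrix over a unital $C^*$-algebra whose entries are projections summing up to $1$ on each row and each column. For $n\geq 1$, the quantum permutation group $S_n^+$ is the compact quantum group (in the sense of Woronowicz) whose algebra $C(S_n^+)$ is the universal $C^*$-algebra generated by the entries of an $n\times n$ magic unitary $u=(u_{ij})$, with comultiplication $\Delta(u_{ij})=\sum_k u_{ik}\otimes u_{kj}$, counit $\varepsilon(u_{ij})=\delta_{ij}$, antipode $S(u_{ij})=u_{ji}$. A closed subgroup $G\subset S_n^+$ is given by a quotient $C(S_n^+)\to C(G)$ compatible with these maps, its magic unitary, still denoted $u$, being the image of the universal one. $G\subset S_n^+$ is doubly transitive when $u_{ij}u_{kl}\neq0$ in $C(G)$ for any $i\neq k$, $j\neq l$. Hopf image: given a unital $*$-homomorphism $\pi:C(S_n^+)\to M_K(C(X))$ with $X$ a compact space, the quantum group associated to $\pi$ is the smallest closed subgroup $G\subset S_n^+$ such that $\pi$ factors through the quotient map $C(S_n^+)\to C(G)$. Hadamard case: $H\in M_N(\mathbb C)$ is a complex Hadamard matrix when $|H_{ij}|=1$ for all $i,j$ and its rows $H_1,\ldots,H_N\in\mathbb C^N$ are pairwise orthogonal. Write $H_i/H_j=(H_{ik}/H_{jk})_k\in\mathbb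 C^N$, and let $P_{ij}\in M_N(\mathbb C)$ be the orthogonal projection onto $\mathbb C\,(H_i/H_j)$. Then $P=(P_{ij})$ is magic, and the quantum group associated to $H$ is the one associated to $\pi:C(S_N^+)\to M_N(\mathbb C)$, $\pi(u_{ij})=P_{ij}$. The profile graph of $H$ is the graph with vertices the pairs $(i,k)\in\{1,\ldots,N\}^2$, with $(i,k)$ and $(j,l)$ joined by an edge when $\sum_{s=1}^N H_{is}\overline{H_{js}}\,\overline{H_{ks}}H_{ls}\neq0$. Weyl case: let $w=e^{2\pi i/N}$, and for $i,a\in\mathbb Z_N$ let $W_{ia}\in U_N$ be the unitary of $\mathbb C^N$ (basis $(e_b)_{b\in\mathbb Z_N}$) given by $W_{ia}e_b=w^{ib}e_{a+b}$; these are the standard Weyl matrices, coming from $\mathbb Z_N\times\mathbb Z_N$ with Fourier cocycle. View $M_N(\mathbb C)$ as a Hilbert space of dimension $N^2$ with scalar product $\langle A,B\rangle=\mathrm{Tr}(AB^* )$, and identify the linear operators on it with $M_{N^2}(\mathbb C)$. With $S_{N^2}^+$ indexed by $\mathbb Z_N\times\mathbb Z_N$, the quantum group associated to the Weyl matrices is the one associated to $\pi:C(S_{N^2}^+)\to M_{N^2}(C(U_N))$, $\pi(u_{ia,jb})=\big[U\mapsto \mathrm{Proj}(W_{ia}UW_{jb}^* )\big]$, where $\mathrm{Proj}(A)$ is the orthogonal projection onto the line $\mathbb C A\subset M_N(\mathbb C)$.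
   Formalization: In (1), ''the profile graph is connected'' is read as: any two vertices (i,k), (j,l) with i≠k, j≠l are joined by a path; on all N² vertices the graph is never connected for N≥2, since the diagonal vertices (i,i) form a separate component, and the claim fails e.g. for the 2×2 Fourier matrix. *)

(* Defs.v *)
(* The field of complex numbers is R[i], for R : realType. *)
From HB Require Import structures.
From mathcomp Require Import all_boot all_order all_algebra.
From mathcomp Require Import complex.
From mathcomp Require Import all_classical all_reals all_analysis.
Set Implicit Arguments.
Unset Strict Implicit.
Unset Printing Implicit Defensive.
Import Order.TTheory GRing.Theory Num.Theory numFieldNormedType.Exports.
Local Open Scope classical_set_scope.
Local Open Scope sesquilinear_scope.
Local Open Scope ring_scope.

(* Unital C*-algebras. The algebra is bundled with its own real-valued norm:
   the analysis library has no structure joining a (noncommutative) algebra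
   with a complete normed module. *)
Record cstarAlg (R : realType) := CStarAlg {
  cstar_sort :> algType R[i];
  cnorm : cstar_sort -> R;
  star : cstar_sort -> cstar_sort;
  cnorm0_eq0 : forall a, cnorm a = 0 -> a = 0;
  cnormD : forall a b, cnorm (a + b) <= cnorm a + cnorm b;
  cnormZ : forall (c : R[i]) a,
    ((cnorm (c *: a))%:C)%C = `|c| * ((cnorm a)%:C)%C;
  cnormM : forall a b, cnorm (a * b) <= cnorm a * cnorm b;
  starK : involutive star;
  starD : forall a b, star (a + b) = star a + star b;
  starZ : forall (c : R[i]) a, star (c *: a) = c^* *: star a;
  starM : forall a b, star (a * b) = star b * star a;
  cstar_id : forall a, cnorm (star a * a) = cnorm a ^+ 2;
  cnorm_complete : forall x : nat -> cstar_sort,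
    (forall e : R, 0 < e -> exists n, forall p q,
       (n <= p)%N -> (n <= q)%N -> cnorm (x p - x q) < e) ->
    exists l, forall e : R, 0 < e -> exists n, forall p,
       (n <= p)%N -> cnorm (x p - l) < e
}.

(* Unital *-homomorphisms. *)
Record starHom (R : realType) (A B : cstarAlg R) := StarHom {
  starHom_fun :> {lrmorphism A -> B};
  starHom_star : forall a, starHom_fun (star a) = star (starHom_fun a)
}.

(* Unital *-homomorphisms A -> M_K(C). *)
Record starRep (R : realType) (A : cstarAlg R) (K : nat) := StarRep {
  starRep_fun :> {lrmorphism A -> 'M[R[i]]_K};
  starRep_star : forall a, starRep_fun (star a) = (starRep_fun a)^t*
}.

(* Unital *-homomorphisms A -> M_K(C(X)), an element of M_K(C(X)) being seen as
   a function X -> M_K(C) with continuous entries. *)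
Record matrixModel (R : realType) (A : cstarAlg R) (X : topologicalType)
    (K : nat) := MatrixModel {
  matrixModel_fun :> X -> starRep A K;
  matrixModel_continuous : forall a k l,
    continuous (fun x => matrixModel_fun x a k l : R[i]^o)
}.

Definition projection (R : realType) (A : cstarAlg R) (p : A) : Prop :=
  star p = p /\ p * p = p.

Definition magic (R : realType) (I : finType) (A : cstarAlg R)
    (u : I -> I -> A) : Prop :=
  [/\ forall i j, projection (u i j),
      forall i, \sum_j u i j = 1
    & forall j, \sum_i u i j = 1].

Definition universal_magic (R : realType) (I : finType) (A : cstarAlg R)
    (u : I -> I -> A) : Prop :=
  magic u /\
  forall (B : cstarAlg R) (v : I -> I -> B), magic v ->
    exists f : starHom A B, (forall i j, f (u i j) = v i j) /\
      forall g : starHom A B, (forall i j, g (u i j) = v i j) -> f =1 g.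

(* The C*-tensor product is the maximal one: a |-> in1 a is a |-> a (x) 1,
   b |-> in2 b is b |-> 1 (x) b, so that a (x) b is in1 a * in2 b. *)
Definition max_tensor (R : realType) (A B T : cstarAlg R)
    (in1 : starHom A T) (in2 : starHom B T) : Prop :=
  (forall a b, in1 a * in2 b = in2 b * in1 a) /\
  forall (D : cstarAlg R) (f1 : starHom A D) (f2 : starHom B D),
    (forall a b, f1 a * f2 b = f2 b * f1 a) ->
    exists f : starHom T D,
      [/\ forall a, f (in1 a) = f1 a, forall b, f (in2 b) = f2 b
        & forall g : starHom T D,
            (forall a, g (in1 a) = f1 a) -> (forall b, g (in2 b) = f2 b) ->
            f =1 g].

(* The quantum permutation group S_I^+ of a finite set I. All its fields are
   determined up to isomorphism by the universal properties. *)
Record qperm (R : realType) (I : finType) := QPerm {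
  qp_alg : cstarAlg R;
  qp_u : I -> I -> qp_alg;
  qp_universal : universal_magic qp_u;
  qp_tensor : cstarAlg R;
  qp_in1 : starHom qp_alg qp_tensor;
  qp_in2 : starHom qp_alg qp_tensor;
  qp_tensorP : max_tensor qp_in1 qp_in2;
  qp_comul : starHom qp_alg qp_tensor;
  qp_comulE : forall i j,
    qp_comul (qp_u i j) = \sum_k qp_in1 (qp_u i k) * qp_in2 (qp_u k j);
  qp_counit : {lrmorphism qp_alg -> R[i] | *%R};
  qp_counit_star : forall a, qp_counit (star a) = (qp_counit a)^*;
  qp_counitE : forall i j, qp_counit (qp_u i j) = (i == j)%:R;
  (* the antipode is a unital *-homomorphism to the opposite algebra *)
  qp_antipode : {linear qp_alg -> qp_alg};
  qp_antipode1 : qp_antipode 1 = 1;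
  qp_antipodeM : forall a b,
    qp_antipode (a * b) = qp_antipode b * qp_antipode a;
  qp_antipode_star : forall a, qp_antipode (star a) = star (qp_antipode a);
  qp_antipodeE : forall i j, qp_antipode (qp_u i j) = qp_u j i
}.

Definition norm_closed (R : realType) (A : cstarAlg R) (J : set A) : Prop :=
  forall a, (forall e : R, 0 < e -> exists2 b, J b & cnorm (a - b) < e) -> J a.

Record closed_ideal (R : realType) (A : cstarAlg R) (J : set A) : Prop :=
  ClosedIdeal {
  closed_ideal0 : J 0;
  closed_idealD : forall a b, J a -> J b -> J (a + b);
  closed_idealMl : forall a b, J b -> J (a * b);
  closed_idealMr : forall a b, J a -> J (a * b);
  closed_ideal_closed : norm_closed J
}.

Definition ideal_gen (R : realType) (A : cstarAlg R) (X : set A) : set A :=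
  [set a | forall J : set A, closed_ideal J -> X `<=` J -> J a].

(* Closed subgroups G of S_I^+. The C*-algebra quotients of A = C(S_I^+) are the
   A / J with J a closed two-sided ideal (automatically a *-ideal), and A / J is
   represented here by J; the three last fields say that the comultiplication,
   counit and antipode of A descend to A / J. For the comultiplication, the
   kernel of A (x) A -> A / J (x) A / J is the closed ideal generated by
   J (x) 1 and 1 (x) J. *)
Record closed_subgroup (R : realType) (I : finType) (S : qperm R I) :=
  ClosedSubgroup {
  cs_ideal : set (qp_alg S);
  cs_idealP : closed_ideal cs_ideal;
  cs_comul : forall a, cs_ideal a ->
    ideal_gen (qp_in1 S @` cs_ideal `|` qp_in2 S @` cs_ideal) (qp_comul S a);
  cs_counit : forall a, cs_ideal a -> qp_counit S a = 0;
  cs_antipode : forall a, cs_ideal a -> cs_ideal (qp_antipode S a)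
}.

(* The images of a and b in C(G) are equal. *)
Definition eq_in (R : realType) (I : finType) (S : qperm R I)
    (G : closed_subgroup S) (a b : qp_alg S) : Prop :=
  cs_ideal G (a - b).

Definition doubly_transitive (R : realType) (I : finType) (S : qperm R I)
    (G : closed_subgroup S) : Prop :=
  forall i j k l, i != k -> j != l -> ~ eq_in G (qp_u S i j * qp_u S k l) 0.

(* G is contained in G': C(S_I^+) -> C(G) factors through C(G'). *)
Definition subgroup_le (R : realType) (I : finType) (S : qperm R I)
    (G G' : closed_subgroup S) : Prop :=
  forall a b, eq_in G' a b -> eq_in G a b.

Definition factors_through (R : realType) (I : finType) (S : qperm R I)
    (V : Type) (f : qp_alg S -> V) (G : closed_subgroup S) : Prop :=
  forall a b, eq_in G a b -> f a = f b.

Definition hopf_image (R : realType) (I : finType) (S : qperm R I)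
    (V : Type) (f : qp_alg S -> V) (G : closed_subgroup S) : Prop :=
  factors_through f G /\
  forall G' : closed_subgroup S, factors_through f G' -> subgroup_le G G'.

(* Orthogonal projection of C^K onto the line spanned by v != 0; matrices act
   on column vectors. *)
Definition line_proj (R : realType) (K : nat) (v : 'cV[R[i]]_K) : 'M[R[i]]_K :=
  (\sum_k `|v k 0| ^+ 2)^-1 *: (v *m v^t*).

Lemma line_proj_id (R : realType) (K : nat) (v : 'cV[R[i]]_K) :
  v != 0 -> line_proj v *m v = v.
Proof.
move=> v0; rewrite /line_proj -scalemxAl -mulmxA.
have -> : v^t* *m v = (\sum_k `|v k 0| ^+ 2)%:M.
  apply/matrixP => a b; rewrite !ord1 !mxE mulr1n.
  by apply: eq_bigr => k _; rewrite !mxE normCK mulrC.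
rewrite mul_mx_scalar scalerA mulVf ?scale1r //.
apply: contraNneq v0 => /eqP.
rewrite psumr_eq0 => [/allP h|k _]; last by rewrite exprn_ge0.
apply/eqP/matrixP => a b; rewrite ord1 mxE.
have /implyP/(_ isT) := h a (mem_index_enum a).
by rewrite sqrf_eq0 normr_eq0 => /eqP.
Qed.

Lemma line_proj_orth (R : realType) (K : nat) (v w : 'cV[R[i]]_K) :
  v^t* *m w = 0 -> line_proj v *m w = 0.
Proof.
by move=> vw; rewrite /line_proj -scalemxAl -mulmxA vw mulmx0 scaler0.
Qed.

Definition complex_hadamard (R : realType) (N : nat) (H : 'M[R[i]]_N) : Prop :=
  (forall i j, `|H i j| = 1) /\
  (forall i j, i != j -> \sum_k H i k * (H j k)^* = 0).

Definition hadamard_proj (R : realType) (N : nat) (H : 'M[R[i]]_N)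
    (i j : 'I_N) : 'M[R[i]]_N :=
  line_proj (\col_k (H i k / H j k)).

Definition hadamard_qgroup (R : realType) (N : nat) (S : qperm R 'I_N)
    (H : 'M[R[i]]_N) (G : closed_subgroup S) : Prop :=
  exists f : starRep (qp_alg S) N,
    (forall i j, f (qp_u S i j) = hadamard_proj H i j) /\ hopf_image f G.

Definition profile_edge (R : realType) (N : nat) (H : 'M[R[i]]_N) :
    rel ('I_N * 'I_N) :=
  fun p q =>
    \sum_s H p.1 s * (H q.1 s)^* * (H p.2 s)^* * H q.2 s != 0.

(* By orthogonality of the rows, a diagonal vertex is joined exactly to the
   diagonal vertices. The diagonal is thus always a connected component, and it
   is the trivial one, corresponding to i = k and j = l in the products
   u_ij u_kl; connectedness of the profile graph is only meaningful for the
   remaining vertices. *)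
Lemma profile_edge_diag (R : realType) (N : nat) (H : 'M[R[i]]_N)
    (i j l : 'I_N) :
  complex_hadamard H -> profile_edge H (i, i) (j, l) = (j == l).
Proof.
move=> [H1 H2]; rewrite /profile_edge /=.
have E : \sum_s H i s * (H j s)^* * (H i s)^* * H l s
    = \sum_s H l s * (H j s)^*.
  apply: eq_bigr => s _.
  by rewrite (mulrAC (H i s)) -normCK H1 expr1n mul1r mulrC.
rewrite {}E; have [->|njl] := eqVneq j l; last by rewrite H2 ?eqxx// eq_sym.
under eq_bigr do rewrite -normCK H1 expr1n.
by rewrite sumr_const card_ord pnatr_eq0; case: N l {H i j H1 H2} => [[]|].
Qed.

Lemma profile_edge_sym (R : realType) (N : nat) (H : 'M[R[i]]_N) :
  symmetric (profile_edge H).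
Proof.
move=> p q; rewrite /profile_edge -[in RHS]conjC_eq0 rmorph_sum /=.
congr (_ != _); apply: eq_bigr => s _.
by rewrite !rmorphM /= !conjCK (mulrC (H p.1 s)) -!mulrA; do 2 congr (_ * _); rewrite mulrC.
Qed.

Definition profile_connected (R : realType) (N : nat) (H : 'M[R[i]]_N) : Prop :=
  forall p q : 'I_N * 'I_N, p.1 != p.2 -> q.1 != q.2 ->
    connect (profile_edge H) p q.

(* e^(2 pi i / N) *)
Definition weyl_root (R : realType) (N : nat) : R[i] :=
  (cos (2 * pi / N%:R) +i* sin (2 * pi / N%:R))%C.

(* W_ia e_b = w^(ib) e_(a+b), with Z_N represented by 'I_N. *)
Definition weyl (R : realType) (N : nat) (ia : 'I_N * 'I_N) : 'M[R[i]]_N :=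
  \matrix_(c, b)
    (((c : nat) == (ia.2 + b) %% N)%N%:R * weyl_root R N ^+ (ia.1 * b)).

Definition unitary_group (R : realType) (N : nat) : topologicalType :=
  initial_topology (fun U : {U : 'M[R[i]]_N | U \is unitarymx} =>
    (sval U : 'M[R[i]^o]_N)).

(* M_N(C), with scalar product Tr(A B^* ), is identified with C^(N*N) by mxvec,
   that is, via the orthonormal basis of matrix units. *)
Definition mx_proj (R : realType) (N : nat) (A : 'M[R[i]]_N) :
    'M[R[i]]_(N * N) :=
  line_proj (mxvec A)^T.

Definition weyl_qgroup (R : realType) (N : nat)
    (S : qperm R ('I_N * 'I_N)%type) (G : closed_subgroup S) : Prop :=
  exists f : matrixModel (qp_alg S) (unitary_group R N) (N * N),
    (forall p q (U : unitary_group R N),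
       f U (qp_u S p q) = mx_proj (weyl R p *m sval U *m (weyl R q)^t*)) /\
    hopf_image (fun a U => f U a) G.

(* Main.v *)
(**
  If J is the ideal of the Hopf image G of f and J is contained in the kernels of
  two matrix representations f and g, then J is also contained in the kernel of
  (f (x) g) o Delta: Delta(J) lies in the closed ideal generated by J (x) 1 and
  1 (x) J.  Multiplying on both sides by suitable projections, this shows that
  the relation between (i,k) and (j,l) given by u_ij u_kl not being in J contains
  the paths whose edges are detected by f.  Conversely, when f detects only the edges of a
  symmetric graph that is invariant under (i,k) -> (k,i), the closed ideal
  generated by the u_ij u_kl with (i,k) and (j,l) in different components defines
  a closed subgroup through which f factors, hence is contained in J.  For a
  Hadamard matrix, f detects exactly the edges of the profile graph.

  In the Weyl case one step is enough: if u_ij u_kl were killed, then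
  Tr(A U B U^* ) = 0 for all unitaries U, where A and B are Weyl matrices up to
  phases.  This passes from B to [X, B] for every X, and implies that A commutes
  with B; so A commutes with [X, B] for every X, which fails when X is a Weyl
  matrix that commutes neither with A nor with B.

  Closed ideals pull back because *-homomorphisms are automatically contractive.
*)
Require Import Defs.
From HB Require Import structures.
From mathcomp Require Import all_boot all_order all_algebra.
From mathcomp Require Import complex.
From mathcomp Require Import all_classical all_reals all_analysis.
From mathcomp Require Import ring lra mxtens.
Set Implicit Arguments.
Unset Strict Implicit.
Unset Printing Implicit Defensive.
Import Order.TTheory GRing.Theory Num.Theory numFieldNormedType.Exports.
Import ComplexField.Normc.
Local Open Scope classical_set_scope.
Local Open Scope sesquilinear_scope.
Local Open Scope ring_scope.

(** * Contractivity of *-homomorphisms *)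

Section CstarNorm.
Variables (R : realType) (A : cstarAlg R).
Implicit Types a b : A.

Lemma cnormZ_real (r : R) a : 0 <= r -> cnorm (r%:C%C *: a) = r * cnorm a.
Proof.
move=> r0; apply: (@complexI R); rewrite cnormZ rmorphM /=.
by rewrite ger0_norm // ler0c.
Qed.

Lemma cnorm0 : cnorm (0 : A) = 0.
Proof. by rewrite -(scale0r (0 : A)) -[0 in LHS]/((0 : R)%:C%C) cnormZ_real // mul0r. Qed.

Lemma cnormN a : cnorm (- a) = cnorm a.
Proof. by apply: (@complexI R); rewrite -scaleN1r cnormZ normrN1 mul1r. Qed.

Lemma cnorm_ge0 a : 0 <= cnorm a.
Proof. by have := cnormD a (- a); rewrite subrr cnorm0 cnormN; lra. Qed.

Lemma cnormB a b : cnorm (a - b) = cnorm (b - a).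
Proof. by rewrite -cnormN opprB. Qed.

Lemma cnorm_gt0 a : a != 0 -> 0 < cnorm a.
Proof.
by move=> a0; rewrite lt0r cnorm_ge0 andbT; apply: contra_neq a0 => /cnorm0_eq0.
Qed.

Lemma cnorm_eq0_lt a : (forall e : R, 0 < e -> cnorm a < e) -> a = 0.
Proof.
move=> h; apply/eqP; apply: contraT => /cnorm_gt0 /h.
by rewrite ltxx.
Qed.

Lemma star0 : star (0 : A) = 0.
Proof. by apply: (addrI (star 0)); rewrite -starD !addr0. Qed.

Lemma starN a : star (- a) = - star a.
Proof. by apply: (addrI (star a)); rewrite -starD !subrr star0. Qed.

Lemma star1 : star (1 : A) = 1.
Proof. by rewrite -[LHS]mulr1 -{2}[1](@starK R A) -starM mulr1 starK. Qed.

(** The C*-identity and submultiplicativity give |b|^2 <= |star b| |b|. Cancelling |b| bounds the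
    norm of b by that of its star, and the involution gives the converse. *)
Lemma cnorm_star a : cnorm (star a) = cnorm a.
Proof.
have h b : cnorm b <= cnorm (star b).
  have [->|b0] := eqVneq b 0; first by rewrite star0.
  have := cnormM (star b) b.
  by rewrite cstar_id expr2 ler_pM2r // cnorm_gt0.
by apply/eqP; rewrite eq_le h andbT -{2}[a](@starK R A) h.
Qed.

Lemma cnorm1_le : cnorm (1 : A) <= 1.
Proof.
have := cstar_id (1 : A); rewrite mulr1 star1.
have := cnorm_ge0 (1 : A).
by nra.
Qed.

(** * Square roots of 1 - x by a contracting iteration *)

Section SquareRoot.
Variables (x : A) (q : R).
Hypotheses (xq : cnorm x <= q) (q1 : q < 1).

(* The fixed point satisfies [(1 - y)^2 = 1 - x]. *)
Definition sqrt_iter (n : nat) : A :=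
  iter n (fun y => (2^-1 : R)%:C%C *: (x + y * y)) 0.

Lemma sqrt_iterS n :
  sqrt_iter n.+1 = (2^-1 : R)%:C%C *: (x + sqrt_iter n * sqrt_iter n).
Proof. by []. Qed.

Lemma sqrt_bound_ge0 : 0 <= q.
Proof. exact: le_trans (cnorm_ge0 x) xq. Qed.

Lemma sqrt_iter_le n : cnorm (sqrt_iter n) <= q.
Proof.
have q0 := sqrt_bound_ge0; elim: n => [|n ih]; first by rewrite cnorm0.
rewrite sqrt_iterS cnormZ_real; last by lra.
have := cnormD x (sqrt_iter n * sqrt_iter n).
have := cnormM (sqrt_iter n) (sqrt_iter n).
have : cnorm (sqrt_iter n) * cnorm (sqrt_iter n) <= q * 1.
  by apply: ler_pM => //; [exact: cnorm_ge0..|exact: le_trans ih (ltW q1)].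
move: ih xq; do ?[move: (cnorm _) => ?]; lra.
Qed.

(** Squaring is 2r-Lipschitz on the ball of radius r. With the factor 1/2 of the iteration, this
    makes the iterated map a contraction of ratio q on the ball of radius q. *)
Lemma cnorm_sqrB (r : R) a b : cnorm a <= r -> cnorm b <= r ->
  cnorm (a * a - b * b) <= 2 * r * cnorm (a - b).
Proof.
move=> ar br.
have -> : a * a - b * b = a * (a - b) + (a - b) * b.
  by rewrite mulrBr mulrBl addrA subrK.
have := cnormD (a * (a - b)) ((a - b) * b).
have := cnormM a (a - b); have := cnormM (a - b) b.
have : cnorm a * cnorm (a - b) <= r * cnorm (a - b).
  by rewrite ler_wpM2r // cnorm_ge0.
have : cnorm (a - b) * cnorm b <= r * cnorm (a - b).
  by rewrite mulrC ler_wpM2r // cnorm_ge0.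
lra.
Qed.

Lemma sqrt_iterB n : cnorm (sqrt_iter n.+1 - sqrt_iter n) <= q ^+ n.
Proof.
have q0 := sqrt_bound_ge0.
elim: n => [|n ih].
  rewrite expr0 subr0; exact: le_trans (sqrt_iter_le 1) (ltW q1).
rewrite (sqrt_iterS n.+1) [X in _ - X]sqrt_iterS -scalerBr cnormZ_real; last by lra.
rewrite opprD addrACA subrr add0r.
have := cnorm_sqrB (sqrt_iter_le n.+1) (sqrt_iter_le n).
have : q * cnorm (sqrt_iter n.+1 - sqrt_iter n) <= q * q ^+ n.
  by apply: ler_wpM2l.
rewrite exprS; do ?[move: (cnorm _) => ?]; lra.
Qed.

Lemma sqrt_iterBn n k :
  (1 - q) * cnorm (sqrt_iter (n + k) - sqrt_iter n) <= q ^+ n.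
Proof.
have q0 := sqrt_bound_ge0.
(* The sharper bound is the partial geometric sum multiplied by 1 - q; unlike q^n alone, it can be
   proved by induction on k. *)
suff : (1 - q) * cnorm (sqrt_iter (n + k) - sqrt_iter n) <= q ^+ n - q ^+ (n + k).
  have : 0 <= q ^+ (n + k) by apply: exprn_ge0.
  lra.
elim: k => [|k ih]; first by rewrite addn0 !subrr cnorm0 mulr0.
rewrite addnS.
have := cnormD (sqrt_iter (n + k).+1 - sqrt_iter (n + k))
               (sqrt_iter (n + k) - sqrt_iter n).
rewrite subrKA => h.
have p0 : 0 <= 1 - q by rewrite subr_ge0 ltW.
have h1 := ler_wpM2l p0 (sqrt_iterB (n + k)).
have h2 := ler_wpM2l p0 h.
rewrite exprS; move: ih h1 h2.
do ?[move: (cnorm _) => ?]; move: (q ^+ n) (q ^+ (n + k)) => ? ?; lra.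
Qed.

Lemma sqrt_iter_cvg : exists y : A, forall e : R, 0 < e -> exists n, forall p,
  (n <= p)%N -> cnorm (sqrt_iter p - y) < e.
Proof.
have q0 := sqrt_bound_ge0.
apply: cnorm_complete => e e0.
have p1 : 0 < 1 - q by rewrite subr_gt0.
have [n hn] : exists n, q ^+ n < (1 - q) * (e / 2).
  have : (GRing.exp q @ \oo --> (0 : R))%classic.
    by apply: cvg_expr; rewrite ger0_norm.
  move=> /cvgrPdist_lt /(_ ((1 - q) * (e / 2))).
  have e' : 0 < (1 - q) * (e / 2) by apply: mulr_gt0 => //; lra.
  move=> /(_ e') [n _ hn]; exists n.
  have := hn n (leqnn n).
  by rewrite /= sub0r normrN ger0_norm // exprn_ge0.
have h k : (n <= k)%N -> cnorm (sqrt_iter k - sqrt_iter n) < e / 2.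
  move=> nk; have := sqrt_iterBn n (k - n); rewrite subnKC // => h.
  by rewrite -(ltr_pM2l p1); apply: le_lt_trans h hn.
exists n => p r np nr.
have := cnormD (sqrt_iter p - sqrt_iter n) (sqrt_iter n - sqrt_iter r).
rewrite subrKA (cnormB (sqrt_iter n)).
have := h _ np; have := h _ nr; lra.
Qed.

Lemma sqrt_iter_star n : star x = x -> star (sqrt_iter n) = sqrt_iter n.
Proof.
move=> xs; elim: n => [|n ih]; first exact: star0.
rewrite sqrt_iterS starZ starD starM ih xs; congr (_ *: _).
exact: conjc_real.
Qed.

Lemma sqrt_iter_comm c n : c * x = x * c -> c * sqrt_iter n = sqrt_iter n * c.
Proof.
move=> cx; elim: n => [|n ih]; first by rewrite mulr0 mul0r.
by rewrite sqrt_iterS -scalerAr -scalerAl mulrDr mulrDl cx mulrA ih -mulrA ih mulrA.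
Qed.

(** The limit y of the iteration satisfies 2y = x + y^2, and k is 1 - y. Self-adjointness and
    commutation with the commutant of x hold for every iterate and pass to the limit. *)
Lemma cstar_sqrt1B : star x = x -> exists k : A, [/\ star k = k, k * k = 1 - x
  & forall c, c * x = x * c -> c * k = k * c].
Proof.
have q0 := sqrt_bound_ge0.
have [y hy] := sqrt_iter_cvg.
(* Each identity about y below is obtained by bounding its defect by the errors of two consecutive
   iterates. *)
have near (u v : A) (M : R) : 0 < M ->
    (forall n, cnorm (u - v) <= M * (cnorm (sqrt_iter n - y))
       + M * (cnorm (sqrt_iter n.+1 - y))) -> u = v.
  move=> M0 h; apply/eqP; rewrite -subr_eq0; apply/eqP.
  apply: cnorm_eq0_lt => e e0.
  have e'0 : 0 < e / (2 * M) by apply: divr_gt0 => //; lra.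
  have [n hn] := hy _ e'0.
  apply: le_lt_trans (h n) _; rewrite -mulrDr.
  have := hn n (leqnn _); have := hn n.+1 (leqnSn _) => h1 h2.
  have -> : e = M * (e / (2 * M) + e / (2 * M)) by field; lra.
  by rewrite ltr_pM2l //; lra.
have ys : star x = x -> star y = y.
  move=> xs.
  apply: (near _ _ 2) => // n.
  have := cnormD (star y - sqrt_iter n) (sqrt_iter n - y).
  rewrite subrKA -{1}(sqrt_iter_star n xs) -starN -starD cnorm_star (cnormB y).
  have := cnorm_ge0 (sqrt_iter n.+1 - y).
  clear; lra.
have ye : y = (2^-1 : R)%:C%C *: (x + y * y).
  (* All iterates and y lie in the ball of radius q + |y|, where half the difference of the squares
     is at most (q + |y|) times the error of the n-th iterate. The remaining 1 covers the error of
     the next one. *)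
  apply: (near _ _ (1 + q + cnorm y)) => [|n].
    by have := cnorm_ge0 y; move: q0; lra.
  have := cnormD (y - sqrt_iter n.+1)
    (sqrt_iter n.+1 - (2^-1 : R)%:C%C *: (x + y * y)).
  rewrite subrKA (cnormB y) {2}sqrt_iterS -scalerBr cnormZ_real; last by lra.
  rewrite opprD addrACA subrr add0r.
  have yr : cnorm y <= q + cnorm y by rewrite lerDr.
  have nr : cnorm (sqrt_iter n) <= q + cnorm y.
    by apply: le_trans (sqrt_iter_le n) _; rewrite lerDl cnorm_ge0.
  have := cnorm_sqrB nr yr.
  have := cnorm_ge0 (sqrt_iter n - y); have := cnorm_ge0 (sqrt_iter n.+1 - y).
  have := cnorm_ge0 y; move: q0.
  move: (cnorm _) (cnorm _) (cnorm _) (cnorm _) (cnorm _) => *; nra.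
have yc c : c * x = x * c -> c * y = y * c.
  move=> cx; apply: (near _ _ (2 * cnorm c + 1)) => [|n].
    by have := cnorm_ge0 c; lra.
  have -> : c * y - y * c = (sqrt_iter n - y) * c - c * (sqrt_iter n - y).
    by rewrite mulrBl mulrBr (sqrt_iter_comm n cx) opprB [RHS]addrC subrKA.
  have := cnormD ((sqrt_iter n - y) * c) (- (c * (sqrt_iter n - y))).
  rewrite cnormN.
  have := cnormM (sqrt_iter n - y) c; have := cnormM c (sqrt_iter n - y).
  have := cnorm_ge0 (sqrt_iter n - y); have := cnorm_ge0 (sqrt_iter n.+1 - y).
  have := cnorm_ge0 c.
  move: (cnorm _) (cnorm _) (cnorm _) (cnorm _) (cnorm _) => *; nra.
move=> xs; exists (1 - y); split.
- by rewrite starD starN star1 ys.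
- have yy : y + y = x + y * y.
    rewrite {1 2}ye -scalerDl -rmorphD /=.
    have -> : 2^-1 + 2^-1 = 1 :> R by field.
    exact: scale1r.
  have -> : x = y + y - y * y by rewrite yy addrK.
  by rewrite mulrBr mulr1 mulrBl mul1r !opprD !opprK !addrA.
- by move=> c cx; rewrite mulrBl mulrBr mul1r mulr1 yc.
Qed.
End SquareRoot.
End CstarNorm.

Section Contractive.
Variables (R : realType) (A B : cstarAlg R).

(* For self-adjoint [h] of norm < 1, [f h + i f (sqrt (1 - h^2))] is a unitary
   of [B] with real part [f h]. *)
Lemma star_morphism_contractive (f : A -> B) :
  (forall a b, f (a + b) = f a + f b) ->
  (forall c a, f (c *: a) = c *: f a) -> f 1 = 1 ->
  (forall a, f (star a) = star (f a)) ->
  (forall a b, f (a * b) = f a * f b) \/ (forall a b, f (a * b) = f b * f a) ->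
  forall a, cnorm (f a) <= cnorm a.
Proof.
move=> fD fZ f1 fs fM.
have sa1 h : star h = h -> cnorm h < 1 -> cnorm (f h) <= 1.
  move=> hs h1.
  have [k [ks kk kc]] : exists k : A, [/\ star k = k, k * k = 1 - h * h
      & forall c, c * (h * h) = h * h * c -> c * k = k * c].
    apply: (@cstar_sqrt1B _ _ _ (cnorm h)) => //; last by rewrite starM hs.
    apply: le_trans (cnormM _ _) _.
    by rewrite -[leRHS]mulr1 ler_wpM2l ?cnorm_ge0 // ltW.
  have hk := kc h (mulrA _ _ _).
  have fhk : f h * f k = f k * f h.
    by case: fM => fM; rewrite -!fM hk.
  have fhh : f h * f h + f k * f k = 1.
    have fM2 b : f b * f b = f (b * b) by case: fM => ->.
    by rewrite !fM2 -fD kk subrKC f1.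
  pose u := f h + 'i *: f k.
  have us : star u = f h - 'i *: f k.
    by rewrite starD starZ -!fs hs ks conjCi scaleNr.
  have uu : star u * u = 1.
    rewrite us mulrDl !mulrDr !mulNr -!scalerAr -!scalerAl -fhk scalerA.
    have -> : 'i * 'i = -1 :> R[i] by rewrite -expr2 sqrCi.
    by rewrite scaleN1r opprK addrA addrK.
  have u1 : cnorm u <= 1.
    have := cstar_id u; rewrite uu; have := cnorm1_le B; have := cnorm_ge0 u.
    by move: (cnorm u) (cnorm 1) => s t ? ? ?; nra.
  have -> : f h = (2^-1 : R)%:C%C *: (u + star u).
    rewrite us /u addrACA subrr addr0 scalerDr -scalerDl -rmorphD /=.
    by have -> : 2^-1 + 2^-1 = 1 :> R by [field]; rewrite scale1r.
  rewrite cnormZ_real //; have := cnormD u (star u); rewrite cnorm_star.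
  by move: u1; do ?[move: (cnorm _) => ?]; lra.
have sa h : star h = h -> cnorm (f h) <= cnorm h.
  move=> hs; apply/ler_addgt0Pr => e e0.
  have m0 : 0 < cnorm h + e by apply: ltr_wpDl => //; exact: cnorm_ge0.
  have := sa1 (((cnorm h + e)^-1)%:C%C *: h).
  have c0 : 0 <= (cnorm h + e)^-1 by rewrite invr_ge0 ltW.
  rewrite fZ !cnormZ_real // starZ hs.
  rewrite ![_^-1 * _]mulrC ltr_pdivrMr // mul1r ltrDl ler_pdivrMr // mul1r.
  by apply => //; congr (_ *: _); exact: conjc_real.
(* The C*-identity reduces the general case to the self-adjoint element [star a * a], or to
   [a * star a], which has the same norm, when f reverses products. *)
move=> a; rewrite -(@ler_pXn2r _ 2) ?nnegrE ?cnorm_ge0 // -!cstar_id -fs.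
case: fM => fM; first by rewrite -fM; apply: sa; rewrite starM starK.
rewrite -fM cstar_id -(cnorm_star a) -(cstar_id (star a)) starK.
by apply: sa; rewrite starM starK.
Qed.

End Contractive.

(** * Closed ideals *)

Section ClosedIdeals.
Variables (R : realType) (A : cstarAlg R).

Lemma closed_ideal_eq0 : closed_ideal [set a : A | a = 0].
Proof.
split => //=.
- by move=> a b -> ->; rewrite addr0.
- by move=> a b ->; rewrite mulr0.
- by move=> a b ->; rewrite mul0r.
- move=> a h; apply: cnorm_eq0_lt => e /h[b ->].
  by rewrite subr0.
Qed.

Lemma ideal_gen_closed (X : set A) : closed_ideal (ideal_gen X).
Proof.
split.
- by move=> J cJ _; exact: closed_ideal0.
- move=> a b ha hb J cJ XJ.
  by apply: closed_idealD => //; [exact: ha|exact: hb].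
- by move=> a b hb J cJ XJ; apply: closed_idealMl => //; exact: hb.
- by move=> a b ha J cJ XJ; apply: closed_idealMr => //; exact: ha.
- move=> a h J cJ XJ; apply: (closed_ideal_closed cJ) => e /h[b hb ab].
  by exists b => //; exact: hb.
Qed.

Lemma sub_ideal_gen (X : set A) : X `<=` ideal_gen X.
Proof. by move=> a Xa J _; exact. Qed.

Lemma ideal_gen_min (X J : set A) :
  closed_ideal J -> X `<=` J -> ideal_gen X `<=` J.
Proof. by move=> cJ XJ a; apply. Qed.

Lemma closed_ideal_sum (J : set A) (I : finType) (F : I -> A) :
  closed_ideal J -> (forall i, J (F i)) -> J (\sum_i F i).
Proof.
by move=> cJ JF; elim/big_ind: _ => //; [exact: closed_ideal0|exact: closed_idealD].
Qed.

(** Contractivity is what makes the preimage norm closed. Maps reversing products are included for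
    the sake of the antipode. *)
Lemma closed_ideal_preimage (B : cstarAlg R) (f : {linear A -> B}) (J : set B) :
  f 1 = 1 -> (forall a, f (star a) = star (f a)) ->
  (forall a b, f (a * b) = f a * f b) \/ (forall a b, f (a * b) = f b * f a) ->
  closed_ideal J -> closed_ideal (f @^-1` J).
Proof.
move=> f1 fs fM cJ.
have fc : forall a, cnorm (f a) <= cnorm a.
  apply: star_morphism_contractive => //; first exact: linearD.
  by move=> c a; rewrite linearZ.
split => /=.
- by rewrite linear0; exact: closed_ideal0.
- by move=> a b Ja Jb; rewrite linearD; exact: closed_idealD.
- move=> a b Jb; case: fM => ->; first exact: closed_idealMl.
  exact: closed_idealMr.
- move=> a b Jb; case: fM => ->; first exact: closed_idealMr.
  exact: closed_idealMl.
- move=> a h; apply: (closed_ideal_closed cJ) => e /h[b Jb ab].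
  by exists (f b) => //; rewrite -linearB; apply: le_lt_trans ab.
Qed.

Lemma starHom_preimage (B : cstarAlg R) (f : starHom A B) (J : set B) :
  closed_ideal J -> closed_ideal (f @^-1` J).
Proof.
apply: (@closed_ideal_preimage B f); first exact: rmorph1.
  exact: starHom_star.
by left; exact: rmorphM.
Qed.

End ClosedIdeals.

Lemma starHom_ker (R : realType) (A B : cstarAlg R) (f : starHom A B) :
  closed_ideal [set a | f a = 0].
Proof. exact: (starHom_preimage f (@closed_ideal_eq0 R B)). Qed.

(** * The operator norm *)

Lemma sqr_discriminant (R : realFieldType) (a b d : R) : 0 <= a ->
  (forall t, 0 <= t ^+ 2 * a + 2 * t * d + b) -> d ^+ 2 <= a * b.
Proof.
move=> a0 H; have [a1|a1] := eqVneq a 0; last first.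
  have {}a0 : 0 < a by rewrite lt0r a1.
  (* This is the point where the quadratic polynomial is minimal. *)
  have := H (- d / a).
  have -> : (- d / a) ^+ 2 * a + 2 * (- d / a) * d + b = (a * b - d ^+ 2) / a.
    by field.
  by rewrite pmulr_lge0 ?invr_gt0 // subr_ge0.
subst a.
have [->|d0] := eqVneq d 0; first by rewrite expr0n mul0r.
(* For a = 0 the polynomial is affine, and it takes the value -1 at this point. *)
have := H (- (b + 1) / (2 * d)).
have -> : 2 * (- (b + 1) / (2 * d)) * d = - (b + 1) by field.
lra.
Qed.

Section HermitianNorm.
Variable R : realType.
Local Notation C := R[i].

(** Keeping only the real part gives a real symmetric bilinear form with the same norm, so that
    Cauchy-Schwarz follows from a real discriminant. *)
Definition rdot (n : nat) (u v : 'cV[C]_n) : R := complex.Re ((u^t* *m v) 0 0).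

Definition vnorm (n : nat) (v : 'cV[C]_n) : R := Num.sqrt (rdot v v).

Lemma rdotE n (u v : 'cV[C]_n) : rdot u v =
  \sum_k (complex.Re (u k 0) * complex.Re (v k 0) +
          complex.Im (u k 0) * complex.Im (v k 0)).
Proof.
rewrite /rdot mxE raddf_sum; apply: eq_bigr => k _.
rewrite !mxE; case: (u k 0) => a b; case: (v k 0) => c d.
by rewrite /= mulNr opprK.
Qed.

Opaque rdot.

Lemma rdotC n (u v : 'cV[C]_n) : rdot u v = rdot v u.
Proof. by rewrite !rdotE; apply: eq_bigr => k _; ring. Qed.

Lemma rdotDl n (u v w : 'cV[C]_n) : rdot (u + v) w = rdot u w + rdot v w.
Proof.
by rewrite !rdotE -big_split; apply: eq_bigr => k _; rewrite !mxE !raddfD /=; ring.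
Qed.

Lemma rdotDr n (u v w : 'cV[C]_n) : rdot u (v + w) = rdot u v + rdot u w.
Proof. by rewrite rdotC rdotDl !(rdotC u). Qed.

Lemma rdotZl n (r : R) (u w : 'cV[C]_n) : rdot (r%:C%C *: u) w = r * rdot u w.
Proof.
rewrite !rdotE mulr_sumr; apply: eq_bigr => k _; rewrite !mxE.
by case: (u k 0) => a b /=; ring.
Qed.

Lemma rdotZr n (r : R) (u w : 'cV[C]_n) : rdot u (r%:C%C *: w) = r * rdot u w.
Proof. by rewrite rdotC rdotZl rdotC. Qed.

Lemma rdot_sqr n (v : 'cV[C]_n) : rdot v v = \sum_k normc (v k 0) ^+ 2.
Proof.
rewrite rdotE; apply: eq_bigr => k _; case: (v k 0) => a b /=.
by rewrite sqr_sqrtr -?expr2 // addr_ge0 ?sqr_ge0.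
Qed.

Lemma rdot_ge0 n (v : 'cV[C]_n) : 0 <= rdot v v.
Proof. by rewrite rdot_sqr; apply: sumr_ge0 => k _; exact: sqr_ge0. Qed.

Lemma vnorm_ge0 n (v : 'cV[C]_n) : 0 <= vnorm v.
Proof. exact: sqrtr_ge0. Qed.

Lemma sqr_vnorm n (v : 'cV[C]_n) : vnorm v ^+ 2 = rdot v v.
Proof. by rewrite sqr_sqrtr // rdot_ge0. Qed.

Lemma rdot_le n (u v : 'cV[C]_n) : rdot u v <= vnorm u * vnorm v.
Proof.
have h : rdot u v ^+ 2 <= rdot u u * rdot v v.
  apply: sqr_discriminant => [|t]; first exact: rdot_ge0.
  have := rdot_ge0 (t%:C%C *: u + v).
  rewrite rdotDl !rdotDr !rdotZl !rdotZr (rdotC v u).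
  by do ?[move: (rdot _ _) => ?]; lra.
rewrite /vnorm -sqrtrM ?rdot_ge0 //.
apply: le_trans (ler_norm _) _.
by rewrite -sqrtr_sqr ler_wsqrtr.
Qed.

Lemma vnormD n (u v : 'cV[C]_n) : vnorm (u + v) <= vnorm u + vnorm v.
Proof.
rewrite -(@ler_pXn2r _ 2) ?nnegrE ?addr_ge0 ?vnorm_ge0 //.
rewrite sqr_vnorm rdotDl !rdotDr (rdotC v u) sqrrD !sqr_vnorm.
have := rdot_le u v; rewrite mulr2n.
by move: (rdot _ _) (rdot _ _) (rdot _ _) (_ * _) => *; lra.
Qed.

Lemma normc_ge0 (c : C) : 0 <= normc c.
Proof. by case: c => a b; exact: sqrtr_ge0. Qed.

Lemma vnormZ n (c : C) (v : 'cV[C]_n) : vnorm (c *: v) = normc c * vnorm v.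
Proof.
rewrite /vnorm !rdot_sqr -[normc c in RHS]ger0_norm ?normc_ge0 //.
rewrite -sqrtr_sqr -sqrtrM ?sqr_ge0 // mulr_sumr; congr Num.sqrt.
by apply: eq_bigr => k _; rewrite mxE normcM exprMn.
Qed.

Lemma normc_le_vnorm n (v : 'cV[C]_n) k : normc (v k 0) <= vnorm v.
Proof.
rewrite -(@ler_pXn2r _ 2) ?nnegrE ?normc_ge0 ?vnorm_ge0 // sqr_vnorm rdot_sqr.
by rewrite (bigD1 k) //= lerDl sumr_ge0 // => j _; exact: sqr_ge0.
Qed.

Lemma vnorm_le_sum n (v : 'cV[C]_n) : vnorm v <= \sum_k normc (v k 0).
Proof.
have s0 : 0 <= \sum_k normc (v k 0) by apply: sumr_ge0 => k _; exact: normc_ge0.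
rewrite -(@ler_pXn2r _ 2) ?nnegrE ?vnorm_ge0 // sqr_vnorm rdot_sqr expr2 mulr_suml.
apply: ler_sum => k _; rewrite expr2 ler_wpM2l ?normc_ge0 //.
by rewrite (bigD1 k) //= lerDl sumr_ge0 // => j _; exact: normc_ge0.
Qed.

Lemma vnorm_delta n (k : 'I_n) : vnorm (delta_mx k 0 : 'cV[C]_n) = 1.
Proof.
rewrite /vnorm rdot_sqr (bigD1 k) //= big1 => [|j jk].
  by rewrite mxE !eqxx normc1 expr1n addr0 sqrtr1.
by rewrite mxE (negbTE jk) normc0 expr0n.
Qed.

Opaque vnorm.

Definition op_bounded n (A : 'M[C]_n) : set R :=
  [set c | 0 <= c /\ forall v : 'cV[C]_n, vnorm (A *m v) <= c * vnorm v].

(** As an infimum of bounds, the norm is estimated from above by exhibiting a bound, and no unit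
    vector has to exist. The infimum is itself a bound, by [opnorm_bounded]. *)
Definition opnorm n (A : 'M[C]_n) : R := inf (op_bounded A).

Lemma normc_sum (I : finType) (F : I -> C) :
  normc (\sum_i F i) <= \sum_i normc (F i).
Proof.
elim/big_ind2: _ => //; first by rewrite normc0.
by move=> a b c d ab cd; apply: le_trans (le_normcD _ _) _; exact: lerD.
Qed.

(** This crude bound shows that the infimum is over a nonempty set; it also turns entrywise
    convergence into norm convergence. *)
Lemma op_bounded_entries n (A : 'M[C]_n) :
  op_bounded A (\sum_i \sum_j normc (A i j)).
Proof.
split; first by do 2 apply: sumr_ge0 => ? _; exact: normc_ge0.
move=> v; apply: le_trans (vnorm_le_sum _) _.
rewrite mulr_suml; apply: ler_sum => i _; rewrite mxE.
apply: le_trans (normc_sum _) _; rewrite mulr_suml; apply: ler_sum => j _.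
by rewrite normcM ler_wpM2l ?normc_ge0 // normc_le_vnorm.
Qed.

Lemma op_bounded_has_inf n (A : 'M[C]_n) : has_inf (op_bounded A).
Proof.
split; first by eexists; exact: op_bounded_entries.
by exists 0 => c [].
Qed.

Lemma opnorm_le n (A : 'M[C]_n) c : op_bounded A c -> opnorm A <= c.
Proof. by move=> Ac; apply: ge_inf => //; case: (op_bounded_has_inf A). Qed.

Lemma opnorm_ge0 n (A : 'M[C]_n) : 0 <= opnorm A.
Proof.
by apply: lb_le_inf => [|c []//]; case: (op_bounded_has_inf A).
Qed.

Lemma opnorm_bounded n (A : 'M[C]_n) : op_bounded A (opnorm A).
Proof.
split=> [|v]; first exact: opnorm_ge0.
have h (e : R) : 0 < e -> vnorm (A *m v) <= (opnorm A + e) * vnorm v.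
  move=> e0; have [c [c0 Ac] ce] := inf_adherent e0 (op_bounded_has_inf A).
  apply: le_trans (Ac v) _; rewrite ler_wpM2r ?vnorm_ge0 //; exact: ltW.
have [v0|v0] := eqVneq (vnorm v) 0.
  by have := h 1 ltr01; rewrite v0 !mulr0.
have v1 : 0 < vnorm v by rewrite lt0r v0 vnorm_ge0.
apply/ler_addgt0Pr => e e0.
have := h (e / vnorm v); rewrite divr_gt0 // => /(_ isT).
by rewrite mulrDl divfK.
Qed.

Lemma opnorm_vnorm n (A : 'M[C]_n) v : vnorm (A *m v) <= opnorm A * vnorm v.
Proof. by case: (opnorm_bounded A). Qed.

Lemma normc_le_opnorm n (A : 'M[C]_n) i j : normc (A i j) <= opnorm A.
Proof.
have -> : A i j = (A *m (delta_mx j 0 : 'cV_n)) i 0 by rewrite -colE mxE.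
apply: le_trans (normc_le_vnorm _ _) _; apply: le_trans (opnorm_vnorm _ _) _.
by rewrite vnorm_delta mulr1.
Qed.

Lemma opnormD n (A B : 'M[C]_n) : opnorm (A + B) <= opnorm A + opnorm B.
Proof.
apply: opnorm_le; split; first by rewrite addr_ge0 ?opnorm_ge0.
move=> v; rewrite mulmxDl mulrDl; apply: le_trans (vnormD _ _) _.
by apply: lerD; exact: opnorm_vnorm.
Qed.

Opaque opnorm.

Lemma opnormM n (A B : 'M[C]_n) : opnorm (A *m B) <= opnorm A * opnorm B.
Proof.
apply: opnorm_le; split; first by rewrite mulr_ge0 ?opnorm_ge0.
move=> v; rewrite -mulmxA -mulrA; apply: le_trans (opnorm_vnorm _ _) _.
by rewrite ler_wpM2l ?opnorm_ge0 // opnorm_vnorm.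
Qed.

Lemma opnormZ_le n (c : C) (A : 'M[C]_n) : opnorm (c *: A) <= normc c * opnorm A.
Proof.
apply: opnorm_le; split; first by rewrite mulr_ge0 ?normc_ge0 ?opnorm_ge0.
move=> v; rewrite -scalemxAl vnormZ -mulrA ler_wpM2l ?normc_ge0 //.
exact: opnorm_vnorm.
Qed.

Lemma opnormZ n (c : C) (A : 'M[C]_n) : opnorm (c *: A) = normc c * opnorm A.
Proof.
apply/eqP; rewrite eq_le opnormZ_le /=.
have [->|c0] := eqVneq c 0; first by rewrite normc0 mul0r opnorm_ge0.
have nc : 0 < normc c.
  by rewrite lt0r normc_ge0 andbT; apply: contra_neq c0 => /eq0_normc.
have := opnormZ_le c^-1 (c *: A); rewrite scalerA mulVf // scale1r normcV.
by rewrite mulrC ler_pdivlMr // mulrC.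
Qed.

Lemma opnorm_eq0 n (A : 'M[C]_n) : opnorm A = 0 -> A = 0.
Proof.
move=> A0; apply/matrixP => i j; rewrite mxE; apply: eq0_normc.
by apply/eqP; rewrite eq_le normc_ge0 andbT -A0 normc_le_opnorm.
Qed.

Lemma trmxCD m n (A B : 'M[C]_(m, n)) : (A + B)^t* = A^t* + B^t*.
Proof. by apply/matrixP => i j; rewrite !mxE rmorphD. Qed.

Lemma trmxCZ m n (c : C) (A : 'M[C]_(m, n)) : (c *: A)^t* = c^* *: A^t*.
Proof. by apply/matrixP => i j; rewrite !mxE rmorphM. Qed.

Lemma trmxC_mul m n p (A : 'M[C]_(m, n)) (B : 'M[C]_(n, p)) :
  (A *m B)^t* = B^t* *m A^t*.
Proof. by rewrite trmx_mul map_mxM. Qed.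

Transparent rdot.

Lemma rdot_adj n (A : 'M[C]_n) u v : rdot (A *m u) v = rdot u (A^t* *m v).
Proof. by rewrite /rdot trmxC_mul mulmxA. Qed.

Opaque rdot.

(** If w is the image of v under the adjoint of A, then |w|^2 is the product of A w with v, hence at
    most |A| |w| |v|; divide by |w|. *)
Lemma opnorm_star_le n (A : 'M[C]_n) : opnorm (A^t*) <= opnorm A.
Proof.
apply: opnorm_le; split=> [|v]; first exact: opnorm_ge0.
set w := A^t* *m v.
have [->|w0] := eqVneq (vnorm w) 0; first by rewrite mulr_ge0 ?opnorm_ge0 ?vnorm_ge0.
have w1 : 0 < vnorm w by rewrite lt0r w0 vnorm_ge0.
rewrite -(ler_pM2l w1) -expr2 sqr_vnorm {2}/w -rdot_adj.
apply: le_trans (rdot_le _ _) _.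
rewrite mulrA; apply: (ler_wpM2r (vnorm_ge0 v)).
by rewrite mulrC; exact: opnorm_vnorm.
Qed.

(** For the lower bound, |A v|^2 is the product of v with [A^t* *m A] applied to v, so the square
    root of the norm of [A^t* *m A] is a bound for A. *)
Lemma opnorm_cstar n (A : 'M[C]_n) : opnorm (A^t* *m A) = opnorm A ^+ 2.
Proof.
apply/eqP; rewrite eq_le; apply/andP; split.
  rewrite expr2; apply: le_trans (opnormM _ _) _.
  exact: (ler_wpM2r (opnorm_ge0 A) (opnorm_star_le A)).
have s0 := opnorm_ge0 (A^t* *m A).
rewrite -[leRHS](sqr_sqrtr s0) ler_pXn2r ?nnegrE ?sqrtr_ge0 ?opnorm_ge0 //.
apply: opnorm_le; split=> [|v]; first exact: sqrtr_ge0.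
rewrite -(@ler_pXn2r _ 2) ?nnegrE ?mulr_ge0 ?sqrtr_ge0 ?vnorm_ge0 //.
rewrite exprMn (sqr_sqrtr s0) sqr_vnorm rdot_adj mulmxA.
apply: le_trans (rdot_le _ _) _; rewrite mulrC expr2 mulrA.
by rewrite ler_wpM2r ?vnorm_ge0 // opnorm_vnorm.
Qed.

End HermitianNorm.

(** * Matrices as a C*-algebra *)

Lemma cauchy_cvg_real (R : realType) (x : nat -> R) :
  (forall e, 0 < e -> exists n, forall p q,
    (n <= p)%N -> (n <= q)%N -> `|x p - x q| < e) ->
  exists l : R, x @ \oo --> l.
Proof.
move=> h; apply/cvg_ex/cauchy_cvgP/cauchy_exP => e /h[n hn].
by exists (x n), n => // p /= np; apply: hn.
Qed.

Section MatrixCstar.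
Variable R : realType.

Lemma normc_le (c : R[i]) : normc c <= `|complex.Re c| + `|complex.Im c|.
Proof.
case: c => a b /=; rewrite -(@ler_pXn2r _ 2) ?nnegrE ?addr_ge0 ?sqrtr_ge0 //.
rewrite sqr_sqrtr ?addr_ge0 ?sqr_ge0 // sqrrD !real_normK ?num_real //.
by rewrite lerD2r lerDl mulrn_wge0 // mulr_ge0.
Qed.

Lemma Re_le_normc (c : R[i]) : `|complex.Re c| <= normc c.
Proof. by case: c => a b /=; rewrite -sqrtr_sqr ler_wsqrtr // lerDl sqr_ge0. Qed.

Lemma Im_le_normc (c : R[i]) : `|complex.Im c| <= normc c.
Proof. by case: c => a b /=; rewrite -sqrtr_sqr ler_wsqrtr // lerDr sqr_ge0. Qed.

Lemma opnorm_complete n (x : nat -> 'M[R[i]]_n) :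
  (forall e : R, 0 < e -> exists n, forall p q,
     (n <= p)%N -> (n <= q)%N -> opnorm (x p - x q) < e) ->
  exists l, forall e : R, 0 < e -> exists n, forall p,
     (n <= p)%N -> opnorm (x p - l) < e.
Proof.
move=> h.
have hRe i j : exists l : R, (fun p => complex.Re (x p i j)) @ \oo --> l.
  apply: cauchy_cvg_real => e /h[m hm]; exists m => p q mp mq.
  apply: le_lt_trans (hm _ _ mp mq); rewrite -raddfB.
  apply: le_trans (Re_le_normc _) _.
  by have := normc_le_opnorm (x p - x q) i j; rewrite !mxE.
have hIm i j : exists l : R, (fun p => complex.Im (x p i j)) @ \oo --> l.
  apply: cauchy_cvg_real => e /h[m hm]; exists m => p q mp mq.
  apply: le_lt_trans (hm _ _ mp mq); rewrite -raddfB.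
  apply: le_trans (Im_le_normc _) _.
  by have := normc_le_opnorm (x p - x q) i j; rewrite !mxE.
pose a i j := sval (cid (hRe i j)); pose b i j := sval (cid (hIm i j)).
pose l : 'M[R[i]]_n := \matrix_(i, j) (a i j +i* b i j)%C.
exists l => e e0.
pose s p := \sum_i \sum_j (`|complex.Re (x p i j) - a i j| +
                           `|complex.Im (x p i j) - b i j|).
have xs p : opnorm (x p - l) <= s p.
  apply: le_trans (opnorm_le (op_bounded_entries _)) _.
  apply: ler_sum => i _; apply: ler_sum => j _.
  by rewrite !mxE; case: (x p i j) => u v; exact: normc_le.
have s0 : s @ \oo --> (0 : R).
  (* Writing 0 in the shape of [s] at the limit allows convergence to be proved term by term. *)
  rewrite [0 in X in _ --> X](_ : 0 = \sum_(i < n) \sum_(j < n) (`|a i j - a i j| + `|b i j - b i j|)); last first.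
    by rewrite big1 // => i _; rewrite big1 // => j _; rewrite !subrr normr0 addr0.
  have cvg_sumR (F : 'I_n -> nat -> R) (c : 'I_n -> R) :
      (forall i, F i @ \oo --> c i) ->
      (fun p => \sum_i F i p) @ \oo --> \sum_i c i.
    by move=> Fc; apply: cvg_big => //; exact: add_continuous.
  apply: (cvg_sumR) => i; apply: (cvg_sumR) => j.
  apply: cvgD; apply: cvg_norm; apply: cvgB; try exact: cvg_cst.
    exact: (svalP (cid (hRe i j))).
  exact: (svalP (cid (hIm i j))).
move/cvgrPdist_lt : s0 => /(_ e e0)[m _ hm]; exists m => p mp.
apply: le_lt_trans (xs p) _; apply: le_lt_trans (hm p mp).
by rewrite /= sub0r normrN ler_norm.
Qed.

Definition mx_cstar (n : nat) : cstarAlg R.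
Proof.
apply: (@CStarAlg R 'M[R[i]]_n.+1 (@opnorm R n.+1) (fun A => A^t*)).
- exact: opnorm_eq0.
- exact: opnormD.
- by move=> c a; rewrite opnormZ rmorphM.
- exact: opnormM.
- exact: trmxCK.
- exact: trmxCD.
- exact: trmxCZ.
- exact: trmxC_mul.
- exact: opnorm_cstar.
- exact: opnorm_complete.
Defined.

End MatrixCstar.

Definition mk_starHom (R : realType) (A B : cstarAlg R) (f : A -> B)
    (f_linear : linear f) (f_monoid : monoid_morphism f)
    (f_star : forall a, f (star a) = star (f a)) : starHom A B :=
  @StarHom R A B
    (HB.pack_for {lrmorphism A -> B} f (GRing.isLinear.Build _ _ _ _ f f_linear)
       (GRing.isMonoidMorphism.Build _ _ f f_monoid)) f_star.

(** * Tensor products of matrix algebras *)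

Lemma mxtrace_adj_eq0 (R : realType) (n : nat) (M : 'M[R[i]]_n) :
  \tr (M^t* *m M) = 0 -> M = 0.
Proof.
have -> : \tr (M^t* *m M) = \sum_i \sum_j `|M j i| ^+ 2.
  apply: eq_bigr => i _; rewrite mxE; apply: eq_bigr => j _.
  by rewrite !mxE normCK mulrC.
have ge0 i j : 0 <= `|M j i| ^+ 2 by rewrite exprn_ge0.
move=> /psumr_eq0P h; apply/matrixP => j i; rewrite mxE.
have /psumr_eq0P hi := h (fun i _ => sumr_ge0 _ (fun j _ => ge0 i j)) i isT.
have /eqP := hi (fun j _ => ge0 i j) j isT.
by rewrite sqrf_eq0 normr_eq0 => /eqP.
Qed.

(** Compressing the sum by P_b shows that the P_b P_c P_b with c != b sum to 0. Each is M^* M for M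
    = P_c P_b, so its trace is nonnegative, hence zero, and M vanishes. The trace stands in for
    positivity in the C*-algebra. *)
Lemma mx_projections_orth (R : realType) (n : nat) (I : finType)
    (P : I -> 'M[R[i]]_n) :
  (forall a, (P a)^t* = P a) -> (forall a, P a *m P a = P a) ->
  \sum_a P a = 1%:M -> forall a b, a != b -> P a *m P b = 0.
Proof.
move=> Ps PP P1 a b ab.
have E c : (P c *m P b)^t* *m (P c *m P b) = P b *m P c *m P b.
  by rewrite trmxC_mul !Ps -mulmxA (mulmxA (P c)) PP mulmxA.
have : \sum_(c | c != b) \tr (P b *m P c *m P b) = 0.
  rewrite -raddf_sum /= -mulmx_suml -mulmx_sumr.
  have -> : \sum_(c | c != b) P c = 1%:M - P b.
    by rewrite -P1 [in RHS](bigD1 b) //= [RHS]addrC addKr.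
  by rewrite mulmxBr mulmx1 PP subrr mul0mx mxtrace0.
have ge0 c : 0 <= \tr (P b *m P c *m P b).
  rewrite -E; apply: sumr_ge0 => i _; rewrite mxE; apply: sumr_ge0 => j _.
  by rewrite !mxE mulrC mul_conjC_ge0.
move=> /psumr_eq0P h; apply: mxtrace_adj_eq0; rewrite E.
by apply: h => // c _.
Qed.

Section TensorMatrix.
Variables (R : realType) (n m : nat).

(** [mx_cstar] shifts the size by one, and the successor of [m + n * m.+1] is [n.+1 * m.+1] by
    computation. *)
Local Notation tens_alg := (mx_cstar R (m + n * m.+1)).

Definition tensl (a : mx_cstar R n) : tens_alg :=
  tensmx (a : 'M[R[i]]_n.+1) (1%:M : 'M[R[i]]_m.+1).

Definition tensr (b : mx_cstar R m) : tens_alg :=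
  tensmx (1%:M : 'M[R[i]]_n.+1) (b : 'M[R[i]]_m.+1).

Lemma tensl_linear : linear tensl.
Proof. by move=> c a b; apply/matrixP => i j; rewrite !mxE mulrDl mulrA. Qed.

Lemma tensr_linear : linear tensr.
Proof. by move=> c a b; apply/matrixP => i j; rewrite !mxE mulrDr mulrCA. Qed.

Lemma tens11 :
  tensmx (1%:M : 'M[R[i]]_n.+1) (1%:M : 'M[R[i]]_m.+1) = 1%:M.
Proof.
apply/matrixP => i j.
case: (mxtens_indexP i) => a b; case: (mxtens_indexP j) => c d.
rewrite tensmxE !mxE (can_eq (@mxtens_indexK _ _)) xpair_eqE.
by rewrite -natrM mulnb.
Qed.

Lemma tensl_monoid : monoid_morphism tensl.
Proof.
split=> [|a b]; first exact: tens11.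
have := tensmx_mul (a : 'M[R[i]]_n.+1) (1%:M : 'M[R[i]]_m.+1) b 1%:M.
by rewrite mulmx1 => /esym.
Qed.

Lemma tensr_monoid : monoid_morphism tensr.
Proof.
split=> [|a b]; first exact: tens11.
have := tensmx_mul (1%:M : 'M[R[i]]_n.+1) (a : 'M[R[i]]_m.+1) 1%:M b.
by rewrite mulmx1 => /esym.
Qed.

Lemma tensl_star a : tensl (star a) = star (tensl a).
Proof.
have := map_mxT Num.conj (a^T : 'M[R[i]]_n.+1) (1%:M : 'M[R[i]]_m.+1).
by rewrite -{1}trmx1 -trmx_tens map_mx1 => /esym.
Qed.

Lemma tensr_star a : tensr (star a) = star (tensr a).
Proof.
have := map_mxT Num.conj (1%:M : 'M[R[i]]_n.+1) (a^T : 'M[R[i]]_m.+1).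
by rewrite -{1}trmx1 -trmx_tens map_mx1 => /esym.
Qed.

Lemma tensl_tensr (a : mx_cstar R n) (b : mx_cstar R m) :
  tensl a * tensr b = tensmx (a : 'M[R[i]]_n.+1) (b : 'M[R[i]]_m.+1).
Proof.
have := tensmx_mul (a : 'M[R[i]]_n.+1) (1%:M : 'M[R[i]]_m.+1) 1%:M b.
by rewrite mulmx1 mul1mx.
Qed.

Lemma tensr_tensl (a : mx_cstar R n) (b : mx_cstar R m) :
  tensr b * tensl a = tensmx (a : 'M[R[i]]_n.+1) (b : 'M[R[i]]_m.+1).
Proof.
have := tensmx_mul (1%:M : 'M[R[i]]_n.+1) (b : 'M[R[i]]_m.+1) a 1%:M.
by rewrite mulmx1 mul1mx.
Qed.

Lemma tensl_tensr_eq0 (a : mx_cstar R n) (b : mx_cstar R m) :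
  tensl a * tensr b = 0 -> a = 0 \/ b = 0.
Proof.
rewrite tensl_tensr => ab0.
have [->|a0] := eqVneq a 0; first by left.
right; have /matrix0Pn[i [j aij]] : (a : 'M[R[i]]_n.+1) != 0 by [].
apply/matrixP => k l; rewrite mxE.
have {}ab0 : tensmx a b = 0 :> 'M[R[i]]_(n.+1 * m.+1, n.+1 * m.+1) := ab0.
have := tensmxE a b i k j l.
by rewrite ab0 mxE => /esym/eqP; rewrite mulf_eq0 (negbTE aij) => /eqP.
Qed.

Definition tensl_hom : starHom (mx_cstar R n) tens_alg :=
  mk_starHom tensl_linear tensl_monoid tensl_star.

Definition tensr_hom : starHom (mx_cstar R m) tens_alg :=
  mk_starHom tensr_linear tensr_monoid tensr_star.

End TensorMatrix.

(** * Composites of *-homomorphisms, and the counit as a representation *)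

Section StarHomConstructions.
Variable R : realType.

Lemma starHom_comp_linear (A B D : cstarAlg R) (g : starHom B D) (f : starHom A B) :
  linear (g \o f).
Proof. by move=> c a b; rewrite /= !linearP. Qed.

Lemma starHom_comp_monoid (A B D : cstarAlg R) (g : starHom B D) (f : starHom A B) :
  monoid_morphism (g \o f).
Proof. by split=> [|a b] /=; rewrite ?rmorph1 ?rmorphM. Qed.

Lemma starHom_comp_star (A B D : cstarAlg R) (g : starHom B D) (f : starHom A B) a :
  (g \o f) (star a) = star ((g \o f) a).
Proof. by rewrite /= !starHom_star. Qed.

Definition starHom_comp (A B D : cstarAlg R) (g : starHom B D) (f : starHom A B) :
    starHom A D :=
  mk_starHom (starHom_comp_linear g f) (starHom_comp_monoid g f)
    (starHom_comp_star g f).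

Definition starRep_hom (A : cstarAlg R) (n : nat) (f : starRep A n.+1) :
  starHom A (mx_cstar R n) := @StarHom R A (mx_cstar R n) f (starRep_star f).

Lemma counit_linear (I : finType) (S : qperm R I) :
  linear (fun a => (qp_counit S a)%:M : mx_cstar R 0).
Proof.
by move=> c a b; apply/matrixP => i j; rewrite !ord1 linearP !mxE !mulr1n.
Qed.

Lemma counit_monoid (I : finType) (S : qperm R I) :
  monoid_morphism (fun a => (qp_counit S a)%:M : mx_cstar R 0).
Proof. by split=> [|a b]; rewrite ?rmorph1 // rmorphM scalar_mxM. Qed.

Lemma counit_mx_star (I : finType) (S : qperm R I) (a : qp_alg S) :
  (qp_counit S (star a))%:M = star ((qp_counit S a)%:M : mx_cstar R 0).
Proof.
by apply/matrixP => i j; rewrite qp_counit_star !ord1 !mxE !mulr1n.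
Qed.

(** Matrices of size 1 let the counit be treated like any matrix representation: it handles empty
    paths, and its kernel is a closed ideal. *)
Definition counit_hom (I : finType) (S : qperm R I) :
    starHom (qp_alg S) (mx_cstar R 0) :=
  mk_starHom (@counit_linear I S) (@counit_monoid I S) (@counit_mx_star I S).

End StarHomConstructions.

(** * Orbitals and Hopf images *)

Section Orbitals.
Variables (R : realType) (I : finType) (S : qperm R I) (G : closed_subgroup S).
Implicit Types p q r : I * I.

(** Row indices form one pair and column indices the other: u_ij u_kl is attached to (i,k) and
    (j,l), as in the profile graph. *)
Definition orbital p q : qp_alg S := qp_u S p.1 q.1 * qp_u S p.2 q.2.

Lemma counit_orbital p q : qp_counit S (orbital p q) = (p == q)%:R.
Proof.
apply: etrans (rmorphM (qp_counit S) _ _) _.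
apply: etrans (congr2 *%R (qp_counitE S _ _) (qp_counitE S _ _)) _.
by rewrite -natrM mulnb -xpair_eqE -!surjective_pairing.
Qed.

Lemma comul_orbital p q : qp_comul S (orbital p q) =
  \sum_i \sum_k qp_in1 S (orbital p (i, k)) * qp_in2 S (orbital (i, k) q).
Proof.
apply: etrans (rmorphM (qp_comul S) _ _) _.
apply: etrans (congr2 *%R (qp_comulE S _ _) (qp_comulE S _ _)) _.
rewrite mulr_suml; apply: eq_bigr => i _; rewrite mulr_sumr.
apply: eq_bigr => k _.
rewrite mulrA -[X in X * _]mulrA -(qp_tensorP S).1 mulrA -mulrA.
by congr (_ * _); rewrite -rmorphM.
Qed.

Lemma starHom_magic_orth n (f : starHom (qp_alg S) (mx_cstar R n)) i a b :
  a != b -> f (qp_u S i a) * f (qp_u S i b) = 0.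
Proof.
have [[u_proj u_row _] _] := qp_universal S.
apply: (@mx_projections_orth _ _ _ (fun a => f (qp_u S i a) : 'M[R[i]]_n.+1)).
- by move=> c; have := starHom_star f (qp_u S i c); rewrite (u_proj i c).1.
- by move=> c; have := rmorphM f (qp_u S i c) (qp_u S i c); rewrite (u_proj i c).2.
- by rewrite -[LHS]/(\sum_a f (qp_u S i a)) -rmorph_sum u_row rmorph1.
Qed.

(* [h] is the convolution [(f (x) g) o Delta]. *)
Lemma orbital_convolution n m (f : starHom (qp_alg S) (mx_cstar R n))
    (g : starHom (qp_alg S) (mx_cstar R m)) p r q :
  (forall a, cs_ideal G a -> f a = 0) -> (forall a, cs_ideal G a -> g a = 0) ->
  f (orbital p r) <> 0 -> g (orbital r q) <> 0 ->
  exists K (h : starHom (qp_alg S) (mx_cstar R K)),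
    (forall a, cs_ideal G a -> h a = 0) /\ h (orbital p q) <> 0.
Proof.
move=> fG gG fpr grq.
(* The commuting representations f (x) 1 and 1 (x) g factor through the maximal tensor product,
   which gives f (x) g. *)
pose F := starHom_comp (tensl_hom R n m) f.
pose F' := starHom_comp (tensr_hom R n m) g.
have FF' a b : F a * F' b = F' b * F a.
  exact: etrans (tensl_tensr _ _) (esym (tensr_tensl _ _)).
have [h [hF hF' _]] := (qp_tensorP S).2 _ F F' FF'.
exists (m + n * m.+1)%N, (starHom_comp h (qp_comul S)); split.
  move=> a /cs_comul.
  apply: (ideal_gen_min (starHom_ker h)) => _ [[b Gb <-]|[b Gb <-]].
    exact: etrans (hF b) (etrans (congr1 (tensl_hom R n m) (fG b Gb)) (raddf0 _)).
  exact: etrans (hF' b) (etrans (congr1 (tensr_hom R n m) (gG b Gb)) (raddf0 _)).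
pose u := qp_u S.
have hu i j : h (qp_comul S (u i j)) = \sum_k F (u i k) * F' (u k j).
  rewrite qp_comulE rmorph_sum; apply: eq_bigr => k _.
  by rewrite rmorphM; congr (_ * _); [exact: hF|exact: hF'].
have Fsq i j : F (u i j) * F (u i j) = F (u i j).
  by rewrite -rmorphM; have [[/(_ i j)[_ ->]]] := qp_universal S.
have F'sq i j : F' (u i j) * F' (u i j) = F' (u i j).
  by rewrite -rmorphM; have [[/(_ i j)[_ ->]]] := qp_universal S.
(* The image of u_ij is the sum over k of the products F(u_ik) F'(u_kj), which are pairwise
   orthogonal projections; hence it absorbs each of them, on either side. *)
have hul i j k : F (u i k) * F' (u k j) * h (qp_comul S (u i j)) =
    F (u i k) * F' (u k j).
  rewrite hu mulr_sumr (bigD1 k) //= big1 => [|l lk].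
    by rewrite addr0 mulrA -[_ * F (u i k)]mulrA -FF' mulrA Fsq -mulrA F'sq.
  rewrite mulrA -[_ * F (u i l)]mulrA -FF' mulrA.
  have -> : F (u i k) * F (u i l) = 0.
    rewrite -[LHS](rmorphM (tensl_hom R n m)) starHom_magic_orth ?raddf0 //.
    by rewrite eq_sym.
  by rewrite !mul0r.
have hur i j k : h (qp_comul S (u i j)) * (F (u i k) * F' (u k j)) =
    F (u i k) * F' (u k j).
  rewrite hu mulr_suml (bigD1 k) //= big1 => [|l lk].
    by rewrite addr0 mulrA -[_ * F (u i k)]mulrA -FF' mulrA Fsq -mulrA F'sq.
  rewrite mulrA -[_ * F (u i k)]mulrA -FF' mulrA.
  have -> : F (u i l) * F (u i k) = 0.
    by rewrite -[LHS](rmorphM (tensl_hom R n m)) starHom_magic_orth ?raddf0.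
  by rewrite !mul0r.
rewrite /= /orbital !rmorphM => h0.
have : F (orbital p r) * F' (orbital r q) = 0.
  rewrite /orbital !rmorphM.
  (* Of the sum over all intermediate pairs, multiplication by these two projections retains only
     the term at r. The two inner factors are the image of [orbital p q], assumed to vanish. *)
  transitivity (F (u p.1 r.1) * F' (u r.1 q.1) * h (qp_comul S (u p.1 q.1)) *
    (h (qp_comul S (u p.2 q.2)) * (F (u p.2 r.2) * F' (u r.2 q.2)))).
    rewrite hul hur -!mulrA; congr (_ * _); rewrite !mulrA; congr (_ * _).
    by rewrite FF'.
  by rewrite mulrA -[_ * h _ * h _]mulrA h0 mulr0 mul0r.
by move=> /tensl_tensr_eq0 [].
Qed.

(** The induction on the path carries an unspecified representation that kills the ideal of G, since
    each edge convolves with one more copy of f and enlarges the matrices. The counit handles the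
    empty path. *)
Lemma connect_orbital n (f : starHom (qp_alg S) (mx_cstar R n))
    (e : rel (I * I)) p q :
  (forall a, cs_ideal G a -> f a = 0) ->
  (forall p q, e p q -> f (orbital p q) <> 0) ->
  connect e p q -> ~ cs_ideal G (orbital p q).
Proof.
move=> fG fe epq Gpq.
suff [K [h [hG]]] : exists K (h : starHom (qp_alg S) (mx_cstar R K)),
    (forall a, cs_ideal G a -> h a = 0) /\ h (orbital p q) <> 0.
  by apply; exact: hG.
have [s] := connectP epq; elim: s p {epq Gpq} => [|r s ih] p /=.
  move=> _ ->; exists 0, (counit_hom S); split.
    by move=> a Ga /=; rewrite (cs_counit Ga) raddf0.
  rewrite /= counit_orbital eqxx => /matrixP/(_ 0 0)/eqP.
  by rewrite !mxE oner_eq0.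
move=> /andP[epr /ih h] /h[K [g [gG grq]]].
exact: (orbital_convolution fG gG (fe _ _ epr) grq).
Qed.

(** * The closed subgroup defined by the components of a graph *)

Section Component.
Variable e : rel (I * I).
Hypothesis e_sym : symmetric e.
Hypothesis e_swap : forall p q, e (p.2, p.1) (q.2, q.1) = e p q.

Let swap p := (p.2, p.1).

(** Needed for the antipode: it reverses products and transposes indices, so it sends [orbital p q]
    to [orbital (swap q) (swap p)]. *)
Lemma connect_swap p q : connect e (swap p) (swap q) = connect e p q.
Proof.
have h r s : connect e r s -> connect e (swap r) (swap s).
  move=> /connectP[t]; elim: t r => [|x t ih] r /=; first by move=> _ ->.
  move=> /andP[erx /ih h] /h; apply: connect_trans; apply: connect1.
  by rewrite e_swap.
by apply/idP/idP => /h //; case: p => ? ?; case: q.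
Qed.

Definition disconnected_ideal : set (qp_alg S) :=
  ideal_gen [set a | exists p q, ~~ connect e p q /\ a = orbital p q].

Lemma disconnected_closed : closed_ideal disconnected_ideal.
Proof. exact: ideal_gen_closed. Qed.

Lemma orbital_disconnected p q :
  ~~ connect e p q -> disconnected_ideal (orbital p q).
Proof. by move=> pq; apply: sub_ideal_gen; exists p, q. Qed.

(** If p and q are not connected, every intermediate pair is disconnected from p or from q, so each
    term of the comultiplication has a tensor factor in the ideal. *)
Lemma disconnected_comul a : disconnected_ideal a ->
  ideal_gen (qp_in1 S @` disconnected_ideal `|` qp_in2 S @` disconnected_ideal)
    (qp_comul S a).
Proof.
set X := _ `|` _; have cX := ideal_gen_closed X.
apply: (ideal_gen_min (starHom_preimage _ cX)) => _ [p [q [pq ->]]] /=.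
rewrite comul_orbital; apply: closed_ideal_sum => // i.
apply: closed_ideal_sum => // k.
have [pik|pik] := boolP (connect e p (i, k)).
  apply: (closed_idealMl cX); apply: sub_ideal_gen; right.
  eexists; last reflexivity; apply: (@orbital_disconnected (i, k) q).
  by apply: contra pq; exact: connect_trans.
apply: (closed_idealMr cX); apply: sub_ideal_gen; left.
by eexists; last reflexivity; exact: orbital_disconnected.
Qed.

Lemma disconnected_counit a : disconnected_ideal a -> qp_counit S a = 0.
Proof.
move=> da; suff : counit_hom S a = 0.
  by move=> /matrixP/(_ 0 0); rewrite !mxE mulr1n.
move: a da; apply: (ideal_gen_min (starHom_ker (counit_hom S))).
move=> _ [p [q [pq ->]]] /=; rewrite counit_orbital.
by case: eqVneq pq => [->|_ _]; [rewrite connect0|rewrite raddf0].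
Qed.

Lemma disconnected_antipode a :
  disconnected_ideal a -> disconnected_ideal (qp_antipode S a).
Proof.
move: a; apply: ideal_gen_min.
  apply: (closed_ideal_preimage (qp_antipode1 S) (@qp_antipode_star _ _ S)).
    by right; exact: qp_antipodeM.
  exact: disconnected_closed.
move=> _ [p [q [pq ->]]]; rewrite /= qp_antipodeM !qp_antipodeE.
apply: (@orbital_disconnected (swap q) (swap p)).
by rewrite connect_swap (sym_connect_sym e_sym).
Qed.

Definition disconnected_subgroup : closed_subgroup S :=
  ClosedSubgroup disconnected_closed disconnected_comul disconnected_counit
    disconnected_antipode.

(** A disconnected pair is not an edge, so f kills all generators of the ideal and factors through
    [disconnected_subgroup]; minimality of the Hopf image then applies. *)
Lemma not_connect_orbital n (f : starRep (qp_alg S) n.+1) p q :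
  hopf_image f G -> (forall p q, f (orbital p q) <> 0 -> e p q) ->
  ~~ connect e p q -> cs_ideal G (orbital p q).
Proof.
move=> [_ Gmax] fe pq; rewrite -[orbital p q]subr0.
apply: (Gmax disconnected_subgroup); last first.
  by rewrite /eq_in subr0; exact: orbital_disconnected.
move=> a b ab; apply/eqP; rewrite -subr_eq0 -raddfB; apply/eqP; move: ab.
rewrite /eq_in /=; move: (a - b).
apply: (ideal_gen_min (starHom_ker (starRep_hom f))) => _ [r [s [rs ->]]].
apply: contrapT => frs; move: rs; rewrite connect1 //; exact: fe.
Qed.

End Component.
End Orbitals.

(** * Hadamard matrices *)

(** For the direct implication, the projections fix v and w, so the scalar product of v and w does
    not change when both projections are inserted between them. *)
Lemma line_proj_mul_eq0 (R : realType) (K : nat) (v w : 'cV[R[i]]_K) :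
  v != 0 -> w != 0 -> line_proj v *m line_proj w = 0 <-> v^t* *m w = 0.
Proof.
move=> v0 w0; split=> [vw|vw].
  have pv : v^t* *m line_proj v = v^t*.
    rewrite -[RHS](congr1 (fun M => M^t*) (line_proj_id v0)) trmxC_mul.
    congr (_ *m _); rewrite /line_proj trmxCZ trmxC_mul trmxCK; congr (_ *: _).
    rewrite fmorphV rmorph_sum; congr (_^-1); apply: eq_bigr => k _.
    by rewrite rmorphXn /= conj_Creal // normr_real.
  by rewrite -(line_proj_id w0) -pv -mulmxA (mulmxA (line_proj v)) vw mul0mx mulmx0.
rewrite [line_proj w]/line_proj -scalemxAr mulmxA line_proj_orth //.
by rewrite mul0mx scaler0.
Qed.

Section Hadamard.
Variables (R : realType) (N : nat) (H : 'M[R[i]]_N).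
Hypothesis H_hadamard : complex_hadamard H.

Lemma hadamard_neq0 i j : H i j != 0.
Proof. by rewrite -normr_eq0 H_hadamard.1 oner_eq0. Qed.

Lemma hadamard_conj i j : (H i j)^* = (H i j)^-1.
Proof. by rewrite invC_norm H_hadamard.1 expr1n invr1 mul1r. Qed.

Lemma hadamard_proj_mul (p q : 'I_N * 'I_N) :
  hadamard_proj H p.1 q.1 *m hadamard_proj H p.2 q.2 <> 0 <-> profile_edge H p q.
Proof.
have v0 i j : \col_k (H i k / H j k) != 0.
  apply/matrix0Pn; exists i, 0; rewrite mxE mulf_neq0 ?invr_neq0 //;
  exact: hadamard_neq0.
rewrite /hadamard_proj line_proj_mul_eq0 //.
(* Entries of modulus 1 have their conjugates as inverses, so this scalar product is the conjugate
   of the sum defining the profile graph. *)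
have -> : (\col_k (H p.1 k / H q.1 k))^t* *m \col_k (H p.2 k / H q.2 k)
  = ((\sum_s H p.1 s * (H q.1 s)^* * (H p.2 s)^* * H q.2 s)^*)%:M.
  apply/matrixP => a b; rewrite !ord1 !mxE mulr1n rmorph_sum.
  apply: eq_bigr => s _; rewrite !mxE !rmorphM /= !conjCK fmorphV /=.
  by rewrite !hadamard_conj invrK; ring.
rewrite /profile_edge; split.
  by apply: contra_notN => /eqP ->; rewrite conjC0 raddf0.
by move=> /eqP h /matrixP/(_ 0 0)/eqP; rewrite !mxE mulr1n conjC_eq0 => /eqP.
Qed.

Lemma profile_edge_swap (p q : 'I_N * 'I_N) :
  profile_edge H (p.2, p.1) (q.2, q.1) = profile_edge H p q.
Proof.
rewrite /profile_edge /= -[in LHS]conjC_eq0 rmorph_sum.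
congr (_ != _); apply: eq_bigr => s _.
by rewrite !rmorphM /= !conjCK; ring.
Qed.

End Hadamard.

Lemma hadamard_doubly_transitive (R : realType) (N : nat) (S : qperm R 'I_N)
    (H : 'M[R[i]]_N) (G : closed_subgroup S) :
  (0 < N)%N -> complex_hadamard H -> hadamard_qgroup H G ->
  doubly_transitive G <-> profile_connected H.
Proof.
case: N S H G => // N S H G _ HH [f [fu Gf]].
have f_orbital p q : f (orbital S p q) =
    hadamard_proj H p.1 q.1 *m hadamard_proj H p.2 q.2.
  exact: etrans (rmorphM f _ _) (congr2 mulmx (fu _ _) (fu _ _)).
have fG a : cs_ideal G a -> starRep_hom f a = 0.
  move=> Ga; have := Gf.1 a 0; rewrite /eq_in subr0 => /(_ Ga) fa.
  by apply: etrans fa _; exact: raddf0.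
split=> [dtG p q pp qq|H_conn i j k l ik jl].
  apply: contraT => pq; exfalso.
  apply: (dtG p.1 q.1 p.2 q.2 pp qq); rewrite /eq_in subr0.
  apply: (not_connect_orbital (e := profile_edge H) _ _ Gf _ pq).
  - exact: profile_edge_sym.
  - exact: profile_edge_swap.
  - by move=> r s; rewrite f_orbital => /(hadamard_proj_mul HH).
rewrite /eq_in subr0.
apply: (connect_orbital (p := (i, k)) (q := (j, l)) fG (e := profile_edge H)).
  move=> r s /(hadamard_proj_mul HH) rs; rewrite -f_orbital in rs; exact: rs.
exact: H_conn.
Qed.

(** * Traces over unitary orbits *)

Section RankOneSpan.
Variables (R : realType) (n : nat).
Local Notation C := R[i].

(** Polarization with v = e_i + z e_j: z = 1 gives F(E_ij) + F(E_ji) = 0, z = i gives F(E_ij) =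
    F(E_ji), so F vanishes on matrix units. *)
Lemma linear_rank_one_eq0 (V : lmodType C) (F : {linear 'M[C]_n -> V}) :
  (forall v : 'cV[C]_n, F (v *m v^t*) = 0) -> forall X, F X = 0.
Proof.
move=> Fv.
have Fd i j : F (delta_mx i j) = 0.
  have dd (a b : 'I_n) : (delta_mx a 0 : 'cV[C]_n) *m (delta_mx b 0 : 'cV[C]_n)^t* = delta_mx a b.
    have -> : (delta_mx b 0 : 'cV[C]_n)^t* = delta_mx 0 b.
      by rewrite trmx_delta map_delta_mx.
    by rewrite mul_delta_mx.
  have Fdd a : F (delta_mx a a) = 0 by rewrite -dd Fv.
  have Fz (z : C) : z * z^* = 1 ->
      z^* *: F (delta_mx i j) + z *: F (delta_mx j i) = 0.
    move=> z1; have := Fv (delta_mx i 0 + z *: delta_mx j 0).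
    rewrite trmxCD trmxCZ mulmxDl !mulmxDr -!scalemxAl -!scalemxAr !dd.
    by rewrite scalerA z1 scale1r !raddfD /= !linearZ /= !Fdd add0r addr0.
  have F1 : F (delta_mx i j) + F (delta_mx j i) = 0.
    by have := Fz 1; rewrite conjC1 mulr1 !scale1r => /(_ erefl).
  have Fi : F (delta_mx j i) = F (delta_mx i j).
    have := Fz 'i; rewrite conjCi mulrN -expr2 sqrCi opprK => /(_ erefl).
    rewrite scaleNr addrC -scalerBr => /eqP; rewrite scaler_eq0 (negbTE (neq0Ci _)) /=.
    by rewrite subr_eq0 => /eqP.
  move: F1; rewrite Fi -mulr2n -scaler_nat => /eqP.
  by rewrite scaler_eq0 pnatr_eq0 => /eqP.
move=> X; rewrite [X]matrix_sum_delta linear_sum big1 // => i _.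
rewrite linear_sum big1 // => j _.
by apply: etrans (linearZ_LR F _ _) _; rewrite Fd scaler0.
Qed.

(* Compare the conjugates of [B] by the unitaries [1 + (z - 1) P], for [z = i] and
   [z = -i], where [P] is the projection onto the line of [v]. *)
Lemma trace_unitary_orbit_bracket (A B : 'M[C]_n) (v : 'cV[C]_n) :
  (forall U, U \is unitarymx -> \tr (A *m (U *m B *m U^t*)) = 0) ->
  forall U, U \is unitarymx ->
    \tr (A *m (U *m (v *m v^t* *m B - B *m (v *m v^t*)) *m U^t*)) = 0.
Proof.
move=> AB U Uu; have [->|v0] := eqVneq v 0.
  by rewrite !(mul0mx, mulmx0) subrr !(mul0mx, mulmx0) mxtrace0.
set q := \sum_k `|v k 0| ^+ 2; set P := line_proj v.
have vP : v *m v^t* = q *: P.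
  rewrite /P /line_proj scalerA mulfV ?scale1r //.
  apply: contraNneq (v0) => q0.
  by rewrite -(line_proj_id v0) /line_proj -/q q0 invr0 scale0r mul0mx.
have Ps : P^t* = P.
  rewrite /P /line_proj trmxCZ trmxC_mul trmxCK; congr (_ *: _).
  rewrite fmorphV rmorph_sum; congr (_^-1); apply: eq_bigr => k _.
  by rewrite rmorphXn /= conj_Creal // normr_real.
have PP : P *m P = P.
  by rewrite {2 3}/P /line_proj -scalemxAr mulmxA line_proj_id.
clearbody P q.
pose V (z : C) := 1%:M + (z - 1) *: P.
have Vs z : (V z)^t* = V z^*.
  by rewrite /V trmxCD trmxCZ Ps rmorphB /= conjC1 trmx1 map_mx1.
have Vu : forall z, z * z^* = 1 -> V z \is unitarymx.
  move=> z z1; apply/unitarymxP; rewrite Vs /V mulmxDl mul1mx mulmxDr mulmx1.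
  rewrite -scalemxAl -scalemxAr PP scalerA -addrA.
  rewrite -scalerDl -scalerDl.
  have -> : z^* - 1 + ((z - 1) + (z - 1) * (z^* - 1)) = z * z^* - 1 by ring.
  by rewrite z1 subrr scale0r addr0.
have VBV z w : V z *m B *m V w = B + (z - 1) *: (P *m B) + (w - 1) *: (B *m P)
   + ((z - 1) * (w - 1)) *: (P *m B *m P).
  rewrite /V !(mulmxDl, mulmxDr) !mul1mx !mulmx1 -!scalemxAl -!scalemxAr scalerA.
  by rewrite !addrA.
pose T M : C := \tr (A *m (U *m M *m U^t*)).
have TD M M' : T (M + M') = T M + T M' by rewrite /T mulmxDr mulmxDl mulmxDr mxtraceD.
have TZ c M : T (c *: M) = c * T M.
  by rewrite /T -scalemxAr -scalemxAl -scalemxAr mxtraceZ.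
clearbody V.
have T4 (M M1 M2 M3 : 'M[C]_n) a b c : T (M + a *: M1 + b *: M2 + c *: M3) =
    T M + a * T M1 + b * T M2 + c * T M3.
  by rewrite TD TD TD TZ TZ TZ.
have h z z' : z' = z^* -> z * z' = 1 -> T (V z *m B *m V z') = 0.
  move=> -> z1; rewrite -[RHS](AB (U *m V z)); last exact: mul_unitarymx Uu (Vu _ z1).
  by rewrite /T trmxC_mul Vs !mulmxA.
have i1 : 'i * - 'i = 1 :> C by rewrite mulrN -expr2 sqrCi opprK.
have hi : T (V 'i *m B *m V (- 'i)) = 0 by apply: h => //; rewrite conjCi.
have hNi : T (V (- 'i) *m B *m V 'i) = 0.
  by apply: h; [rewrite rmorphN /= conjCi opprK | rewrite mulrC].
suff : T (v *m v^t* *m B - B *m (v *m v^t*)) = 0 by [].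
clearbody T; rewrite vP.
rewrite -scalemxAl -scalemxAr -scaleN1r !(TD, TZ).
move: hi hNi; rewrite !VBV !T4.
move: (T B) (T (P *m B)) (T (B *m P)) (T (P *m B *m P)) => b pb bp pbp e e'.
(* The terms in B and P B P have equal coefficients in both expansions and cancel in the
   difference. *)
have {e e'} : 2 * 'i * (pb - bp) = 0 by rewrite -[RHS](subrr 0) -{1}e -e'; ring.
by move=> /eqP; rewrite !mulf_eq0 pnatr_eq0 (negbTE (neq0Ci _)) /= subr_eq0 => /eqP ->; ring.
Qed.

(** The bracket lemma at U = 1 and cyclicity give Tr((BA - AB) X) = 0 for X of rank one, hence for
    every X by linearity. Take for X the adjoint of BA - AB. *)
Lemma trace_unitary_orbit_comm (A B : 'M[C]_n) :
  (forall U, U \is unitarymx -> \tr (A *m (U *m B *m U^t*)) = 0) ->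
  A *m B = B *m A.
Proof.
move=> AB; pose M := B *m A - A *m B.
suff : M = 0 by move=> /eqP; rewrite subr_eq0 => /eqP.
have M0 X : \tr (M *m X) = 0.
  pose F Y : C^o := \tr (M *m Y).
  have F_linear : linear F.
    by move=> c Y Z; rewrite /F mulmxDr -scalemxAr mxtraceD mxtraceZ.
  pose F' : {linear 'M[C]_n -> C^o} :=
    HB.pack F (GRing.isLinear.Build _ _ _ _ F F_linear).
  apply: (linear_rank_one_eq0 (F := F')) => v /=.
  have one_unitary : (1%:M : 'M[C]_n) \is unitarymx.
    by apply/unitarymxP; rewrite trmx1 map_mx1 mulmx1.
  rewrite -[RHS](trace_unitary_orbit_bracket v AB one_unitary).
  move: (v *m v^t*) => P; rewrite trmx1 map_mx1 mul1mx mulmx1 mulmxBr.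
  rewrite /F /M mulmxBl !raddfB /= mulmxA.
  by congr (_ - _); [rewrite -[in LHS]mulmxA [LHS]mxtrace_mulC|rewrite mulmxA].
by apply: mxtrace_adj_eq0; rewrite mxtrace_mulC; exact: M0.
Qed.

(** For X = v v^* the bracket [X, B] inherits the trace condition, so it commutes with A.
    Commutation is linear in X, so rank one suffices. *)
Lemma trace_unitary_orbit_bracket_comm (A B X : 'M[C]_n) :
  (forall U, U \is unitarymx -> \tr (A *m (U *m B *m U^t*)) = 0) ->
  A *m (X *m B - B *m X) = (X *m B - B *m X) *m A.
Proof.
move=> AB.
pose G Y := Y *m B - B *m Y; pose F Y := A *m G Y - G Y *m A.
have G_linear : linear G.
  move=> c Y Z; rewrite /G mulmxDl mulmxDr -scalemxAl -scalemxAr scalerBr.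
  by rewrite opprD addrACA.
have F_linear : linear F.
  move=> c Y Z; rewrite /F G_linear mulmxDl mulmxDr -scalemxAl -scalemxAr.
  by rewrite scalerBr opprD addrACA.
pose F' : {linear 'M[C]_n -> 'M[C]_n} := HB.pack F (GRing.isLinear.Build _ _ _ _ F F_linear).
apply/eqP; rewrite -subr_eq0; apply/eqP.
apply: (linear_rank_one_eq0 (F := F')) => v /=.
apply/eqP; rewrite subr_eq0; apply/eqP.
exact: trace_unitary_orbit_comm (trace_unitary_orbit_bracket v AB).
Qed.

(** Here [X, B] = (nu - 1) B X, so A commutes with B X as well as with B. Moving A across X costs
    mu, whence (1 - mu) B A X = 0, against invertibility. *)
Lemma trace_unitary_orbit_neq0 (A B X : 'M[C]_n) (mu nu : C) :
  (0 < n)%N -> A \in unitmx -> B \in unitmx -> X \in unitmx ->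
  X *m A = mu *: (A *m X) -> X *m B = nu *: (B *m X) -> mu != 1 -> nu != 1 ->
  ~ (forall U, U \is unitarymx -> \tr (A *m (U *m B *m U^t*)) = 0).
Proof.
move=> n0 Au Bu Xu XA XB mu1 nu1 AB.
have cAB := trace_unitary_orbit_comm AB.
have := trace_unitary_orbit_bracket_comm X AB.
have -> : X *m B - B *m X = (nu - 1) *: (B *m X).
  by rewrite XB scalerBl scale1r.
rewrite -scalemxAr -scalemxAl -mulmxA XA -scalemxAr !mulmxA cAB.
move=> /(scalerI _) h.
have {h} : (1 - mu) *: (B *m A *m X) = 0.
  rewrite scalerBl scale1r; apply/eqP; rewrite subr_eq0; apply/eqP.
  by apply: h; rewrite subr_eq0.
move=> /eqP; rewrite scaler_eq0 subr_eq0 eq_sym (negbTE mu1) /= => /eqP BAX0.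
have : B *m A *m X \in unitmx by rewrite !unitmx_mul Bu Au Xu.
by rewrite BAX0 -row_free_unit /row_free mxrank0 eq_sym -leqn0 leqNgt n0.
Qed.

End RankOneSpan.

(** * Weyl matrices *)

Section WeylMatrices.
Variables (R : realType) (n : nat).
Local Notation C := R[i].
Local Notation N := n.+1.
Local Notation w := (weyl_root R N).
Local Notation theta := (2 * pi / N%:R : R).

Lemma weyl_rootX d :
  w ^+ d = (cos (d%:R * theta) +i* sin (d%:R * theta))%C.
Proof.
elim: d => [|d ih]; first by rewrite expr0 mul0r cos0 sin0.
have -> : d.+1%:R * theta = theta + d%:R * theta.
  by rewrite -[d.+1]add1n natrD mulrDl mul1r.
rewrite exprS ih cosD sinD.
by apply/eqP; rewrite eq_complex /=; apply/andP; split; apply/eqP; ring.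
Qed.

Lemma weyl_root_unity : w ^+ N = 1.
Proof.
rewrite weyl_rootX mulrC divfK ?pnatr_eq0 // mulrC mulr_natr cos2pi.
by rewrite -[pi *+ 2]add0r sinD2pi sin0.
Qed.

Lemma weyl_root_conj : w^* * w = 1.
Proof.
apply/eqP; rewrite eq_complex /=; apply/andP; split; apply/eqP; last by ring.
by rewrite mulNr opprK -!expr2 cos2Dsin2.
Qed.

Lemma weyl_root_neq0 : w != 0.
Proof. by apply: contra_eqN weyl_root_conj => /eqP ->; rewrite mulr0 eq_sym oner_eq0. Qed.

(** With x = d pi / N strictly between 0 and pi, the real part cos(2x) equals 1 - 2 sin(x)^2 and is
    less than 1. *)
Lemma weyl_root_primitive d : (0 < d < N)%N -> w ^+ d != 1.
Proof.
move=> /andP[d0 dN]; apply/negP; rewrite weyl_rootX eq_complex /= => /andP[/eqP c _].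
pose x : R := d%:R * pi / N%:R.
have xx : d%:R * theta = x + x 
    by rewrite /x -mulr2n -[RHS]mulr_natl !mulrA (mulrC d%:R 2).
have s0 : 0 < sin x.
  apply: sin_gt0_pi; rewrite /x !mulr_gt0 ?invr_gt0 ?pi_gt0 ?ltr0n //=.
  by rewrite ltr_pdivrMr ?ltr0n // mulrC ltr_pM2l ?pi_gt0 // ltr_nat.
have := cos2Dsin2 x; move: c; rewrite xx cosD -!expr2.
have : 0 < sin x ^+ 2 by rewrite exprn_gt0.
lra.
Qed.

Lemma weyl_rootX_inj (a b : 'I_N) : w ^+ a = w ^+ b -> a = b.
Proof.
wlog ab : a b / (a <= b)%N.
  by move=> h; have [|/ltnW] := leqP a b => ab e; [|apply/esym]; exact: h.
move=> e; apply/val_inj/eqP; rewrite eqn_leq ab /= leqNgt; apply/negP => ltab.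
have := @weyl_root_primitive (b - a)%N.
rewrite subn_gt0 ltab (leq_ltn_trans (leq_subr _ _)) // => /(_ isT)/negP; apply.
apply/eqP/(mulfI (expf_neq0 a weyl_root_neq0)).
by rewrite -exprD subnKC // mulr1.
Qed.

(* [weyl] with exponents not reduced modulo [N]. *)
Definition wm (s t : nat) : 'M[C]_N :=
  \matrix_(c, b) (((c : nat) == (t + b) %% N)%N%:R * w ^+ (s * b)).

Lemma wm_mul s t s' t' : wm s t *m wm s' t' = w ^+ (s * t') *: wm (s + s') (t + t').
Proof.
apply/matrixP => c b; rewrite !mxE.
have lt : ((t' + b) %% N < N)%N by rewrite ltn_mod.
rewrite (bigD1 (Ordinal lt)) //= big1 => [|k kb].
  rewrite !mxE /= eqxx mul1r addr0 modnDmr addnA.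
  rewrite -!mulrA [RHS]mulrCA; congr (_ * _).
  have wmod e : w ^+ e = w ^+ (e %% N).
    by rewrite {1}(divn_eq e N) exprD mulnC exprM weyl_root_unity expr1n mul1r.
  rewrite -!exprD wmod [in RHS]wmod; congr (w ^+ _).
  by rewrite -modnDml modnMmr modnDml mulnDr mulnDl addnA.
rewrite !mxE; have /negbTE -> : (k : nat) != ((t' + b) %% N)%N by [].
by rewrite mul0r mulr0.
Qed.

Lemma wm_unitary s t : wm s t \is unitarymx.
Proof.
rewrite -trmxC_unitary; apply/unitarymxP; rewrite trmxCK.
apply/matrixP => b b'; rewrite !mxE.
have lt : ((t + b') %% N < N)%N by rewrite ltn_mod.
rewrite (bigD1 (Ordinal lt)) //= big1 => [|k kb].
  rewrite !mxE /= eqxx mul1r addr0 eqn_modDl !modn_small // rmorphM /=.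
  rewrite conjC_nat -val_eqE /= eq_sym; case: eqVneq => [->|]; last by rewrite !mul0r.
  rewrite mul1r rmorphXn /= -exprMn; by rewrite weyl_root_conj expr1n.
rewrite !mxE; have /negbTE -> : (k : nat) != ((t + b') %% N)%N by [].
by rewrite mul0r mulr0.
Qed.

Lemma wm_comm s t s' t' :
  wm s t *m wm s' t' = (w ^+ (s * t') / w ^+ (s' * t)) *: (wm s' t' *m wm s t).
Proof.
rewrite !wm_mul scalerA (addnC s') (addnC t'); congr (_ *: _).
by rewrite divfK // expf_neq0 // weyl_root_neq0.
Qed.

End WeylMatrices.

(** * Projections onto lines of matrices, and the Weyl case *)

Lemma mulmx_adj_comm (R : realType) (n : nat) (X V W : 'M[R[i]]_n) (a b : R[i]) :
  V \is unitarymx -> b != 0 -> X *m V = b *: (V *m X) -> X *m W = a *: (W *m X) ->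
  X *m (V^t* *m W) = (a / b) *: (V^t* *m W *m X).
Proof.
move=> Vu b0 XV XW.
have VsV : V^t* *m V = 1%:M.
  by have /unitarymxP := Vu; rewrite -trmxC_unitary in Vu; have /unitarymxP := Vu; rewrite trmxCK.
have VVs : V *m V^t* = 1%:M by apply/unitarymxP.
have XVs : X *m V^t* = b^-1 *: (V^t* *m X).
  have -> : V^t* *m X = b *: (X *m V^t*).
    have -> : V^t* *m X = V^t* *m (X *m V) *m V^t* by rewrite -!mulmxA VVs mulmx1.
    by rewrite XV -scalemxAr -scalemxAl !mulmxA VsV mul1mx.
  by rewrite scalerA mulVf // scale1r.
rewrite mulmxA XVs -scalemxAl -[V^t* *m X *m W]mulmxA XW -scalemxAr scalerA mulmxA.
by congr (_ *: _); exact: mulrC.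
Qed.

Lemma mx_proj_mul_eq0 (R : realType) (n : nat) (V W : 'M[R[i]]_n) :
  V != 0 -> W != 0 -> mx_proj V *m mx_proj W = 0 <-> \tr (V *m W^t*) = 0.
Proof.
have nz (A : 'M[R[i]]_n) : A != 0 -> (mxvec A)^T != 0.
  by apply: contra_neq => /(congr1 trmx); rewrite trmxK trmx0 => /eqP; rewrite mxvec_eq0 => /eqP.
move=> V0 W0; rewrite /mx_proj line_proj_mul_eq0 ?nz //.
have -> : (mxvec V)^T^t* *m (mxvec W)^T = ((\tr (V *m W^t*))^*)%:M.
  apply/matrixP => a b; rewrite !ord1 !mxE mulr1n.
  rewrite rmorph_sum (reindex _ (curry_mxvec_bij _ _)) /=.
  transitivity (\sum_i \sum_j (V i j)^* * W i j).
    rewrite pair_bigA; apply: eq_bigr => [[i j]] _ /=.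
    by rewrite !mxE !mxvecE.
  apply: eq_bigr => i _; rewrite mxE rmorph_sum; apply: eq_bigr => j _.
  by rewrite !mxE rmorphM /= conjCK.
split=> [|->]; last by rewrite conjC0 raddf0.
by move=> /matrixP/(_ 0 0)/eqP; rewrite !mxE mulr1n conjC_eq0 => /eqP.
Qed.

Lemma unitarymx_neq0 (R : realType) (n : nat) (V : 'M[R[i]]_n) :
  (0 < n)%N -> V \is unitarymx -> V != 0.
Proof.
move=> n0 /mxrank_unitary Vn; apply: contraTneq n0 => V0.
by rewrite -Vn V0 mxrank0.
Qed.

(** Orthogonality of the two lines is a vanishing trace, which cyclicity brings to the form of a
    trace over the unitary orbit of B. *)
Lemma mx_proj_mul_trace (R : realType) (n : nat) (U P Q S T : 'M[R[i]]_n) :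
  (0 < n)%N -> U \is unitarymx -> P \is unitarymx -> Q \is unitarymx ->
  S \is unitarymx -> T \is unitarymx ->
  mx_proj (P *m U *m Q^t*) *m mx_proj (S *m U *m T^t*) = 0 ->
  \tr ((S^t* *m P) *m (U *m (Q^t* *m T) *m U^t*)) = 0.
Proof.
move=> n0 Uu Pu Qu Su Tu.
have nz (V W : 'M[R[i]]_n) : V \is unitarymx -> W \is unitarymx ->
    V *m U *m W^t* != 0.
  move=> Vu Wu; apply: (unitarymx_neq0 n0); rewrite -trmxC_unitary in Wu.
  exact: mul_unitarymx (mul_unitarymx Vu Uu) Wu.
move=> /(mx_proj_mul_eq0 (nz _ _ Pu Qu) (nz _ _ Su Tu)) <-.
rewrite !trmxC_mul trmxCK; move: (S^t*) (U^t*) (Q^t*) => S' U' Q'.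
by rewrite -[S' *m P *m _]mulmxA mxtrace_mulC -!mulmxA.
Qed.

Lemma weyl_doubly_transitive (R : realType) (N : nat)
    (S : qperm R ('I_N * 'I_N)%type) (G : closed_subgroup S) :
  (0 < N)%N -> weyl_qgroup G -> doubly_transitive G.
Proof.
case: N S G => // n S G _ [f [fu [fG _]]] p q r s pr qs /fG fpq.
have weyl_unitary a : weyl R a \is unitarymx := wm_unitary R n a.1 a.2.
pose w := weyl_root R n.+1.
have wX_neq0 d : w ^+ d != 0 by rewrite expf_neq0 // weyl_root_neq0.
pose A := (weyl R r)^t* *m weyl R p; pose B := (weyl R q)^t* *m weyl R s.
have AB U : U \is unitarymx -> \tr (A *m (U *m B *m U^t*)) = 0.
  move=> Uu; pose U' : unitary_group R n.+1 := exist _ U Uu.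
  have prod0 : mx_proj (weyl R p *m U *m (weyl R q)^t*) *m
      mx_proj (weyl R r *m U *m (weyl R s)^t*) = 0.
    have := congr1 (fun g => g U') fpq; rewrite /= raddf0 => <-.
    apply/esym; apply: etrans (rmorphM (f U') _ _) _.
    exact: (congr2 mulmx (fu _ _ U') (fu _ _ U')).
  exact: (mx_proj_mul_trace (ltn0Sn n) Uu (weyl_unitary p) (weyl_unitary q)
    (weyl_unitary r) (weyl_unitary s) prod0).
have AB_unit (V W : 'M[R[i]]_n.+1) : V \is unitarymx -> W \is unitarymx ->
    V^t* *m W \in unitmx.
  rewrite -trmxC_unitary => Vu Wu; rewrite unitmx_mul.
  by rewrite (unitarymx_unit Vu) (unitarymx_unit Wu).
have A_unit : A \in unitmx by exact: AB_unit.
have B_unit : B \in unitmx by exact: AB_unit.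
(* The scalar by which [wm R n i j] commutes with [weyl R a]. *)
pose c (i j : nat) (a : 'I_n.+1 * 'I_n.+1) := w ^+ (i * a.2) / w ^+ (a.1 * j).
have c_neq0 i j a : c i j a != 0 by rewrite mulf_neq0 ?invr_neq0.
(* A Weyl matrix that does not commute with A must commute with B, by [trace_unitary_orbit_neq0]. *)
have not_comm i j : c i j p != c i j r -> c i j s = c i j q.
  move=> cpr; apply/eqP/contraT => csq; exfalso.
  have Xc a : wm R n i j *m weyl R a = c i j a *: (weyl R a *m wm R n i j).
    exact: wm_comm.
  have XA := mulmx_adj_comm (weyl_unitary r) (c_neq0 i j r) (Xc r) (Xc p).
  have XB := mulmx_adj_comm (weyl_unitary q) (c_neq0 i j q) (Xc q) (Xc s).
  have Xu := unitarymx_unit (wm_unitary R n i j).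
  apply: (trace_unitary_orbit_neq0 (ltn0Sn n) A_unit B_unit Xu XA XB _ _ AB).
  - by apply: contraNneq cpr => /(congr1 ( *%R^~ (c i j r))); rewrite divfK // mul1r => ->.
  - by apply: contraNneq csq => /(congr1 ( *%R^~ (c i j q))); rewrite divfK // mul1r => ->.
have cE1 a : c 1 0 a = w ^+ a.2 by rewrite /c mul1n muln0 expr0 divr1.
have cE2 a : c 0 1 a = (w ^+ a.1)^-1 by rewrite /c mul0n muln1 expr0 div1r.
have cE3 a : c 1 1 a = w ^+ a.2 / w ^+ a.1 by rewrite /c mul1n muln1.
(* Three test matrices suffice: (1,0) detects second coordinates, (0,1) first coordinates, and (1,1)
   the difference of the two. *)
have h1 := not_comm 1 0; rewrite !cE1 in h1.
have h2 := not_comm 0 1; rewrite !cE2 in h2.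
have h3 := not_comm 1 1; rewrite !cE3 in h3.
have wI (a b : 'I_n.+1) : w ^+ a = w ^+ b -> a = b := @weyl_rootX_inj R n a b.
have H1 : p.2 != r.2 -> s.2 = q.2.
  by move=> ne; apply/wI/h1; apply: contra_neq ne => /wI.
have H2 : p.1 != r.1 -> s.1 = q.1.
  by move=> ne; apply/wI/invr_inj/h2; apply: contra_neq ne => /invr_inj/wI.
have pairE (a b : 'I_n.+1 * 'I_n.+1) : a.1 = b.1 -> a.2 = b.2 -> a = b.
  by case: a b => ? ? [? ?] /= -> ->.
move/eqP: qs; apply; apply/esym.
(* The aim is s = q, a contradiction. When p and r differ in a single coordinate, that coordinate of
   s and q agrees by [H1] or [H2], and the test (1,1) yields the other. *)
have [p1|p1] := eqVneq p.1 r.1; have [p2|p2] := eqVneq p.2 r.2.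
- by move: pr; rewrite (pairE _ _ p1 p2) eqxx.
- apply: pairE (H1 p2); apply/wI/invr_inj/(mulfI (wX_neq0 s.2)).
  rewrite {2}(H1 p2); apply: h3; rewrite p1.
  by apply: contra_neq p2 => /(mulIf (invr_neq0 (wX_neq0 r.1)))/wI.
- apply: pairE (H2 p1) _; apply/wI/(mulIf (invr_neq0 (wX_neq0 s.1))).
  rewrite {2}(H2 p1); apply: h3; rewrite p2.
  by apply: contra_neq p1 => /(mulfI (wX_neq0 r.2))/invr_inj/wI.
- exact: pairE (H2 p1) (H1 p2).
Qed.

Theorem proposition5p5 (R : realType) :
  (forall (N : nat) (S : qperm R 'I_N) (H : 'M[R[i]]_N)
      (G : closed_subgroup S),
     (0 < N)%N -> complex_hadamard H -> hadamard_qgroup H G ->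
     (doubly_transitive G <-> profile_connected H)) /\
  (forall (N : nat) (S : qperm R ('I_N * 'I_N)%type) (G : closed_subgroup S),
     (0 < N)%N -> weyl_qgroup G -> doubly_transitive G).
Proof.
split; first exact: hadamard_doubly_transitive.
exact: weyl_doubly_transitive.
Qed.
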